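(* Let $m_1,m_2$ be nonnegative integers, $x\in\mathbb{C}$ with $\Re(x)>0$, and $s\in\mathbb{C}$ with $\Re(s)>m_1+m_2+2$. Writing $a=a(k_2)=m_1+m_2-k_2$, we have $$Z_{m_1,m_2}(s,x)=\sum_{\substack{0\le k\le k_2\le m_2\\ 1\le j\le a+1}}(-1)^{j+m_2-1}(j-1)!\binom{m_2}{m_2-k_2,\,k_2-k,\,k}(-x)^{k_2-k}\Big(S(a+1,j)(s-k)(s-k+1)\,\zeta_{j+1}(s-k+2,x)+a\,S(a,j)(s-k)\,\zeta_{j+1}(s-k+1,x)\Big).$$
   Context: Let $G(t)=\dfrac{t}{1-e^{-t}}$ for $t>0$ (extended by $G(0)=1$), with $j$-th derivative $G^{(j)}$, and $Z_{m_1,m_2}(s,x)=\frac{1}{\Gamma(s)}\int_0^\infty t^{s-1}G^{(m_1)}(t)G^{(m_2)}(t)e^{-xt}\,dt$ for $\Re(s)>m_1+m_2+2$, $\Re(x)>0$. For a positive integer $n$, $\zeta_n(s,x)=\sum_{k_1,\dots,k_n=0}^\infty (x+k_1+\cdots+k_n)^{-s}$ is the multiple Hurwitz zeta function of order $n$. $S(n,j)$ is the Stirling number of the second kind, and $\binom{n}{a,b,c}=\frac{n!}{a!b!c!}$ is the multinomial coefficient. *)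

(* Defs.v *)
From HB Require Import structures.
From mathcomp Require Import all_boot all_order all_algebra.
From mathcomp Require Import complex.
From mathcomp Require Import all_classical all_reals all_analysis.

Set Implicit Arguments.
Unset Strict Implicit.
Unset Printing Implicit Defensive.

Import Order.TTheory GRing.Theory Num.Theory.
Import numFieldNormedType.Exports.

Local Open Scope classical_set_scope.
Local Open Scope complex_scope.
Local Open Scope ring_scope.

Section complex_functions.
Variable R : realType.
Local Notation C := R[i].
Local Notation Re := (@complex.Re R).
Local Notation Im := (@complex.Im R).
Local Notation cabs := (@ComplexField.Normc.normc R).

Definition cexp (z : C) : C :=
  (expR (Re z) * cos (Im z)) +i* (expR (Re z) * sin (Im z)).

(* Principal argument, with values in ]-pi, pi] for z != 0. *)
Definition carg (z : C) : R :=
  if 0 <= Im z then acos (Re z / cabs z) else - acos (Re z / cabs z).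

Definition clog (z : C) : C := ln (cabs z) +i* carg z.

(* Principal value of z ^ s for z != 0. *)
Definition cpow (z s : C) : C := cexp (s * clog z).

(* Lebesgue integral of a complex-valued function on a subset of the line;
   the value is meaningful when both components are integrable. *)
Definition cintegral (D : set R) (f : R -> C) : C :=
  (\int[lebesgue_measure]_(t in D) Re (f t))%R +i*
  (\int[lebesgue_measure]_(t in D) Im (f t))%R.

(* Unordered sum of an absolutely summable real (resp. complex) family. The
   value has no meaning for families that are not summable. *)
Definition rsum (T : choiceType) (f : T -> R) : R :=
  fine (\esum_(k in [set: T]) ((EFin \o f)^\+ k)%E) -
  fine (\esum_(k in [set: T]) ((EFin \o f)^\- k)%E).

Definition csum (T : choiceType) (f : T -> C) : C :=
  rsum (fun k => Re (f k)) +i* rsum (fun k => Im (f k)).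

(* Euler's integral, valid for Re s > 0. *)
Definition Gamma (s : C) : C :=
  cintegral `]0, +oo[ (fun t => cpow t%:C (s - 1) * cexp (- t%:C)).

Definition G (t : R) : R := if t == 0 then 1 else t / (1 - expR (- t)).

Definition Z (m1 m2 : nat) (s x : C) : C :=
  (Gamma s)^-1 *
  cintegral `]0, +oo[
    (fun t => cpow t%:C (s - 1) * (derive1n m1 G t)%:C * (derive1n m2 G t)%:C
              * cexp (- x * t%:C)).

Definition mzeta (n : nat) (s x : C) : C :=
  csum (fun k : {ffun 'I_n -> nat} => cpow (x + (\sum_(i < n) k i)%:R) (- s)).

Definition trinomial (n a b c : nat) : C := n`!%:R / (a`! * b`! * c`!)%:R.

End complex_functions.

Fixpoint stirling2 (n j : nat) : nat :=
  match n, j with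
  | 0, 0 => 1
  | n'.+1, j'.+1 => j'.+1 * stirling2 n' j'.+1 + stirling2 n' j'
  | _, _ => 0
  end%N.

(* Main.v *)
Require Import Defs.
From mathcomp Require Import all_boot all_order all_algebra.
From mathcomp Require Import complex ring lra zify.
From mathcomp Require Import all_classical all_reals all_analysis measurable_realfun.

Set Implicit Arguments.
Unset Strict Implicit.
Unset Printing Implicit Defensive.

Import Order.TTheory GRing.Theory Num.Theory.
Import numFieldNormedType.Exports.

Local Open Scope classical_set_scope.
Local Open Scope complex_scope.
Local Open Scope ring_scope.

(* Write f(t) = 1 / (1 - e^(-t)), so that G(t) = t f(t) and f' = f - f^2; hence
   the derivatives of G are t P(f) + p Q(f) with P, Q polynomials whose
   coefficients are Stirling numbers. Integrating by parts m2 times moves all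
   derivatives from the second factor G^(m2) onto the first one: each step
   replaces a derivative of the second factor by minus the sum of a derivative
   of the first factor, a factor -x, and a lowering of the exponent of t, which
   produces the trinomial coefficients. What remains are the integrals of
   t^(w-1) f(t)^n e^(-xt). Expanding f^n as a geometric series indexed by N^n and
   integrating termwise turns them into Gamma(w) zeta_n(w, x), by the formula
   int t^(w-1) e^(-zt) dt = Gamma(w) z^(-w) for Re z > 0. Finally the functional
   equation of Gamma collects the Gamma factors into Gamma(s), which is nonzero. *)

(** The derivatives of G are regular at 0, but the powers of f into which they are expanded are not,
    so splitting an integral can destroy convergence. The proof therefore tracks a pole order:
    [tame n] bounds a function by t^(-n) times polynomial growth, the integral against t^w e^(-xt)
    converges once n <= Re w, and each differentiation costs one unit of n. The half plane Re s > m1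
    + m2 + 2 pays for every split and for every boundary term. For complex z the formula for
    Gamma(w) z^(-w) is obtained without rotating a contour: the base point is moved along the path
    z^u, 0 <= u <= 1, and integration by parts shows that the derivative in u is zero. Nonvanishing
    of Gamma is a genuine obligation, since the definition of [Z] and the zeta expansion both divide
    by it. A zero at s would propagate to all s + n, which have the same imaginary part tau and
    unbounded real part; there t^(N-1) e^(-t) is so concentrated near t = N that t^(i tau) cannot
    cancel the integral. *)

(** * Real integrals over the open half line *)

Section half_line_integrals.
Context {R : realType}.
Local Notation mu := (@lebesgue_measure R).
Implicit Types (f F : R -> R) (C c t : R).

Let mD : measurable (`]0, +oo[%classic : set (measurableTypeR R)).
Proof. exact: measurable_itv. Qed.

Lemma integrable_expRN c : 0 < c ->
  mu.-integrable `]0, +oo[ (EFin \o (fun t => expR (- c * t))).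
Proof.
move=> c0.
have /(@integrableS _ _ _ mu setT `]0, +oo[) := integrable_exponential_pdf c0.
move=> /(_ measurableT mD (@subsetT _ _)) H.
have H2 := integrableZl mD c^-1 H.
apply: (eq_integrable mD _ _ _ H2) => t; rewrite inE/= in_itv/=.
rewrite andbT => t0; rewrite exponential_pdfE ?ltW//.
by rewrite -EFinM mulrA mulVf ?mul1r// gt_eqF.
Qed.

Lemma continuous_integrable_dominated f C c : 0 < c ->
  (forall t, 0 < t -> {for t, continuous f}) ->
  (forall t, 0 < t -> `|f t| <= C * expR (- c * t)) ->
  mu.-integrable `]0, +oo[ (EFin \o f).
Proof.
move=> c0 cf bf.
apply: (@le_integrable _ _ _ mu _ mD _
  (fun t => C%:E * (EFin \o (fun t => expR (- c * t))) t)%E).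
- apply/measurable_EFinP; apply: open_continuous_measurable_fun => //.
  by move=> t; rewrite inE/= in_itv/= andbT => /cf.
- move=> t; rewrite /= in_itv/= andbT => t0; rewrite lee_fin.
  by apply: le_trans (bf _ t0) _; rewrite ler_norm.
- by apply: integrableZl; [exact: mD|exact: integrable_expRN].
Qed.

(** The two bounds on [F] kill the boundary terms at 0 and at infinity. The fundamental theorem is
    applied on compact intervals exhausting the half line, and dominated convergence with majorant
    |f| passes to the limit. *)
Lemma Rintegral_derive_eq0 F f C :
  (forall t, 0 < t -> is_derive t 1 F (f t)) ->
  (forall t, 0 < t -> {for t, continuous f}) ->
  mu.-integrable `]0, +oo[ (EFin \o f) ->
  (forall t, 0 < t -> `|F t| <= C * t) ->
  (forall t, 0 < t -> `|F t| <= C / t) ->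
  \int[mu]_(t in `]0, +oo[) f t = 0.
Proof.
move=> dF cf intf F0 Foo.
(* The shift by 2 keeps [a n < b n] strict already at [n = 0]. *)
pose a n : R := n.+2%:R^-1; pose b n : R := n.+2%:R.
have a0 n : 0 < a n by rewrite invr_gt0.
have b0 n : 0 < b n by [].
have ab n : a n < b n.
  apply: (@lt_trans _ _ 1); first by rewrite invf_lt1// ltr1n.
  by rewrite /b ltr1n.
have cF t : 0 < t -> {for t, continuous F}.
  by move=> t0; apply/differentiable_continuous/derivable1_diffP; have [] := dF _ t0.
have FTC n : (\int[mu]_(t in `[a n, b n]) (f t)%:E = (F (b n))%:E - (F (a n))%:E)%E.
  apply: (@continuous_FTC2 _ _ F) => //.
  - apply: continuous_in_subspaceT => t; rewrite inE/= in_itv/= => /andP[h _].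
    by apply: cf; exact: lt_le_trans h.
  - split.
    + by move=> t; rewrite in_itv/= => /andP[h _]; have [] := dF _ (lt_trans (a0 n) h).
    + by apply/cvg_at_right_filter; apply: cF.
    + by apply/cvg_at_left_filter; apply: cF.
  - move=> t; rewrite in_itv/= => /andP[h _]; rewrite derive1E.
    by have [] := dF _ (lt_trans (a0 n) h).
pose fn n : R -> \bar R := ((EFin \o f) \_ `[a n, b n]%classic).
have intfn n : (\int[mu]_(t in `]0%R, +oo[) fn n t = (F (b n) - F (a n))%:E)%E.
  rewrite EFinB -FTC /fn -integral_mkcondr; congr (integral _ _ _).
  apply/seteqP; split => [t|t]/=; rewrite !in_itv/= ?andbT.
    by case.
  by move=> h; split=> //; case/andP: h => h _; exact: lt_le_trans h.
have /integrableP[mf _] := intf.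
have cvg1 : (\int[mu]_(t in `]0%R, +oo[) fn n t)%E @[n --> \oo] -->
            (\int[mu]_(t in `]0%R, +oo[) (f t)%:E)%E.
  apply: (@dominated_cvg _ _ _ mu _ mD fn _
     (fun t => `|(EFin \o f) t|)%E).
  - move=> n; apply: (@measurable_funS _ _ _ _ setT) => //.
    apply/(measurable_restrict _ (measurable_itv _)) => //.
    rewrite setTI; apply: measurable_funS mf => //.
    move=> t/=; rewrite !in_itv/= andbT => /andP[h _]; exact: lt_le_trans h.
  - move=> t; rewrite /= in_itv/= andbT => t0.
    apply: cvg_near_cst; near=> n.
    rewrite /fn patchE ifT// inE/= in_itv/=; apply/andP; split.
      rewrite /a -[leRHS]invrK lef_pV2 ?posrE ?invr_gt0//.
      apply: (@le_trans _ _ n%:R); last by rewrite ler_nat; lia.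
      by near: n; exact: nbhs_infty_ger.
    apply: (@le_trans _ _ n%:R); last by rewrite ler_nat; lia.
    by near: n; exact: nbhs_infty_ger.
  - by [].
  - exact: integrable_abse.
  - move=> n t t0; rewrite /fn patchE; case: ifP => // _.
    by rewrite abse0.
have cvg2 : (F (b n) - F (a n)) @[n --> \oo] --> 0.
  apply/norm_cvg0P.
  (* As [a n] is the inverse of [b n], the bound C / t at [b n] and the bound C t at [a n] coincide,
     whence the factor 2. *)
  apply: (@squeeze_cvgr _ _ _ _ (cst 0) (fun n => 2 * C * n.+2%:R^-1)).
  - apply: nearW => n; rewrite normr_ge0/=.
    apply: le_trans (ler_normB _ _) _.
    have h1 := Foo _ (b0 n); have h2 := F0 _ (a0 n).
    by rewrite -mulrA mulr_natl mulr2n; exact: lerD.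
  - exact: cvg_cst.
  - rewrite -(mulr0 (2 * C)); apply: cvgMr.
    have := @cvg_harmonic R; rewrite -(cvg_shiftn 1).
    by under eq_fun do rewrite addn1.
rewrite /Rintegral.
have -> : (\int[mu]_(t in `]0%R, +oo[) (f t)%:E = 0%:E)%E; last by [].
have cvg3 : (\int[mu]_(t in `]0%R, +oo[) fn n t)%E @[n --> \oo] --> 0%:E.
  rewrite (_ : (fun n => _) = EFin \o (fun n => F (b n) - F (a n))).
    by apply: cvg_EFin => //; exact: nearW.
  by apply/funext => n; exact: intfn.
exact: (cvg_unique _ cvg1 cvg3).
Unshelve. all: by end_near. Qed.

End half_line_integrals.

(** * Complex exponentials, and calculus of complex functions of a real variable *)

Section complex_calculus.
Context {R : realType}.
Local Notation mu := (@lebesgue_measure R).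
Local Notation C := R[i].
Local Notation Re := (@complex.Re R).
Local Notation Im := (@complex.Im R).
Local Notation cabs := (@ComplexField.Normc.normc R).
Implicit Types (f g : R -> C) (t : R) (z w : C).

Lemma ReM z w : Re (z * w) = Re z * Re w - Im z * Im w.
Proof. by case: z w => [a b] [c d]. Qed.

Lemma ImM z w : Im (z * w) = Re z * Im w + Im z * Re w.
Proof. by case: z w => [a b] [c d]. Qed.

Lemma ReD z w : Re (z + w) = Re z + Re w.
Proof. by case: z w => [a b] [c d]. Qed.

Lemma ImD z w : Im (z + w) = Im z + Im w.
Proof. by case: z w => [a b] [c d]. Qed.

Lemma complex_eqP z w : Re z = Re w -> Im z = Im w -> z = w.
Proof. by case: z w => [a b] [c d] /= -> ->. Qed.

Lemma Re_le_cabs z : `|Re z| <= cabs z.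
Proof.
case: z => a b /=; rewrite -sqrtr_sqr ler_wsqrtr//.
by rewrite lerDl sqr_ge0.
Qed.

Lemma Im_le_cabs z : `|Im z| <= cabs z.
Proof.
case: z => a b /=; rewrite -sqrtr_sqr ler_wsqrtr//.
by rewrite lerDr sqr_ge0.
Qed.

Lemma cabs_real (a : R) : cabs a%:C = `|a|.
Proof. by rewrite /= expr0n/= addr0 sqrtr_sqr. Qed.

Lemma cabs_ge0 z : 0 <= cabs z.
Proof. exact: le_trans (Re_le_cabs z). Qed.

Lemma cexpD z w : cexp (z + w) = cexp z * cexp w.
Proof.
case: z w => [a b] [c d]; rewrite /cexp /= expRD cosD sinD.
by apply: complex_eqP; rewrite ?(ReM, ImM)/=; ring.
Qed.

Lemma cexp0 : cexp 0 = 1 :> C.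
Proof. by rewrite /cexp/= expR0 cos0 sin0 mulr1 mulr0. Qed.

Lemma cabs_cexp z : cabs (cexp z) = expR (Re z).
Proof.
rewrite /cexp/= !exprMn -mulrDr cos2Dsin2 mulr1 sqrtr_sqr.
by rewrite ger0_norm// expR_ge0.
Qed.

Lemma clog_real t : 0 < t -> clog t%:C = (ln t)%:C.
Proof.
move=> t0; rewrite /clog /carg cabs_real gtr0_norm//= lexx.
by rewrite divff ?acos1// gt_eqF.
Qed.

Lemma cpow_real t w : 0 < t -> cpow t%:C w = cexp (w * (ln t)%:C).
Proof. by move=> t0; rewrite /cpow clog_real. Qed.

Lemma cexp_real t : cexp t%:C = (expR t)%:C.
Proof. by rewrite /cexp/= cos0 sin0 mulr0 mulr1. Qed.

Lemma cpowD t w w' : 0 < t -> cpow t%:C (w + w') = cpow t%:C w * cpow t%:C w'.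
Proof. by move=> t0; rewrite !cpow_real// mulrDl cexpD. Qed.

Lemma cpow1 t : 0 < t -> cpow t%:C 1 = t%:C.
Proof. by move=> t0; rewrite cpow_real// mul1r cexp_real lnK ?posrE. Qed.

Lemma cabs_cpow t w : 0 < t -> cabs (cpow t%:C w) = expR (Re w * ln t).
Proof.
by move=> t0; rewrite cpow_real// cabs_cexp ReM/= mulr0 subr0.
Qed.

(** Componentwise, so that the real product, chain and mean value rules apply to each part, in line
    with the definition of [cintegral]. *)
Definition is_cderive f t (d : C) :=
  is_derive t 1 (Re \o f) (Re d) /\ is_derive t 1 (Im \o f) (Im d).

Definition ccontinuous_at f t :=
  {for t, continuous (Re \o f)} /\ {for t, continuous (Im \o f)}.

Lemma is_derive_continuous (h : R -> R) t d :
  is_derive t 1 h d -> {for t, continuous h}.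
Proof.
by case=> dh _; apply: differentiable_continuous; exact/derivable1_diffP.
Qed.

Lemma is_cderive_continuous f t d : is_cderive f t d -> ccontinuous_at f t.
Proof. by move=> [? ?]; split; apply: is_derive_continuous; eassumption. Qed.

Lemma is_cderive_cst z t : is_cderive (fun=> z) t 0.
Proof.
by split; [have := is_derive_cst (Re z) t (1 : R)|have := is_derive_cst (Im z) t (1 : R)].
Qed.

Lemma is_cderive_real (h : R -> R) t d :
  is_derive t 1 h d -> is_cderive (fun t => (h t)%:C) t d%:C.
Proof.
move=> dh; split; first by [].
by have := is_derive_cst (0 : R) t (1 : R).
Qed.

Lemma is_cderiveM f g t d e : is_cderive f t d -> is_cderive g t e ->
  is_cderive (fun t => f t * g t) t (d * g t + f t * e).
Proof.
move=> [f1 f2] [g1 g2]; split.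
- have h := is_deriveB (is_deriveM f1 g1) (is_deriveM f2 g2).
  rewrite (_ : Re \o _ = (Re \o f) * (Re \o g) - (Im \o f) * (Im \o g)).
    by apply: is_derive_eq h _; rewrite ReD !ReM /GRing.scale/=; ring.
  by apply/funext => u /=; rewrite ReM.
- have h := is_deriveD (is_deriveM f1 g2) (is_deriveM f2 g1).
  rewrite (_ : Im \o _ = (Re \o f) * (Im \o g) + (Im \o f) * (Re \o g)).
    by apply: is_derive_eq h _; rewrite ImD !ImM /GRing.scale/=; ring.
  by apply/funext => u /=; rewrite ImM.
Qed.

Lemma is_cderive_cexp f t d : is_cderive f t d ->
  is_cderive (fun t => cexp (f t)) t (d * cexp (f t)).
Proof.
move=> [f1 f2].
have E := is_derive1_comp (is_derive_expR (Re (f t))) f1.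
have c := is_derive1_comp (is_derive_cos (Im (f t))) f2.
have s := is_derive1_comp (is_derive_sin (Im (f t))) f2.
split.
- apply: is_derive_eq (is_deriveM E c) _.
  by rewrite ReM /GRing.scale/=; ring.
- apply: is_derive_eq (is_deriveM E s) _.
  by rewrite ImM /GRing.scale/=; ring.
Qed.

Lemma is_derive_near_eq (h k : R -> R) t d :
  (\forall u \near t, h u = k u) -> is_derive t 1 h d -> is_derive t 1 k d.
Proof.
move=> hk [dh <-]; split; first exact: near_eq_derivable hk dh.
by apply/esym/near_eq_derive.
Qed.

Lemma is_cderive_near_eq f g t d :
  (\forall u \near t, f u = g u) -> is_cderive f t d -> is_cderive g t d.
Proof.
move=> fg [f1 f2]; split.
- by apply: is_derive_near_eq f1; apply: filterS fg => u /= ->.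
- by apply: is_derive_near_eq f2; apply: filterS fg => u /= ->.
Qed.

Lemma is_cderive_cpow t w : 0 < t ->
  is_cderive (fun t => cpow t%:C w) t (w * cpow t%:C (w - 1)).
Proof.
move=> t0.
apply: (@is_cderive_near_eq (fun t => cexp (w * (ln t)%:C))).
  near=> u; rewrite cpow_real//; near: u; exact: lt_nbhsr.
have -> : w * cpow t%:C (w - 1) =
    (0 * (ln t)%:C + w * (t^-1)%:C) * cexp (w * (ln t)%:C).
  (* The factor 1/t from the derivative of ln is absorbed by lowering the exponent. *)
  have e : cpow t%:C w = cpow t%:C (w - 1) * t%:C.
    by have := cpowD (w - 1) 1 t0; rewrite subrK (cpow1 t0).
  rewrite -cpow_real// mul0r add0r e mulrACA -mulrA -rmorphM mulVf ?gt_eqF//.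
  by rewrite mulr1.
apply: is_cderive_cexp; apply: is_cderiveM; first exact: is_cderive_cst.
by apply: is_cderive_real; exact: is_derive1_ln.
Unshelve. all: by end_near. Qed.

Definition cintegrable f :=
  mu.-integrable `]0, +oo[ (EFin \o (Re \o f)) /\
  mu.-integrable `]0, +oo[ (EFin \o (Im \o f)).

Let mD : measurable (`]0, +oo[%classic : set (measurableTypeR R)).
Proof. exact: measurable_itv. Qed.

Lemma eq_cintegral f g : (forall t, 0 < t -> f t = g t) ->
  cintegral `]0, +oo[ f = cintegral `]0, +oo[ g.
Proof.
move=> fg; congr (_ +i* _); apply: eq_Rintegral => t;
  by rewrite inE/= in_itv/= andbT => /fg ->.
Qed.

Lemma cintegrableD f g : cintegrable f -> cintegrable g ->
  cintegrable (fun t => f t + g t).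
Proof.
move=> [f1 f2] [g1 g2]; split.
- apply: (eq_integrable mD _ _ _ (integrableD mD f1 g1)) => t _ /=.
  by rewrite ReD.
- apply: (eq_integrable mD _ _ _ (integrableD mD f2 g2)) => t _ /=.
  by rewrite ImD.
Qed.

Lemma cintegralD f g : cintegrable f -> cintegrable g ->
  cintegral `]0, +oo[ (fun t => f t + g t) =
  cintegral `]0, +oo[ f + cintegral `]0, +oo[ g.
Proof.
move=> [f1 f2] [g1 g2]; apply: complex_eqP; rewrite ?(ReD, ImD) /=.
- rewrite -(RintegralD mD f1 g1); apply: eq_Rintegral => t _ /=.
  by rewrite ReD.
- rewrite -(RintegralD mD f2 g2); apply: eq_Rintegral => t _ /=.
  by rewrite ImD.
Qed.

Lemma cintegrableZ z f : cintegrable f -> cintegrable (fun t => z * f t).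
Proof.
move=> [f1 f2]; split.
- apply: (eq_integrable mD _ _ _ (integrableB mD
    (integrableZl mD (Re z) f1) (integrableZl mD (Im z) f2))) => t _ /=.
  by rewrite ReM.
- apply: (eq_integrable mD _ _ _ (integrableD mD
    (integrableZl mD (Re z) f2) (integrableZl mD (Im z) f1))) => t _ /=.
  by rewrite ImM.
Qed.

Lemma cintegralZ z f : cintegrable f ->
  cintegral `]0, +oo[ (fun t => z * f t) = z * cintegral `]0, +oo[ f.
Proof.
move=> [f1 f2].
have i1 (r : R) : mu.-integrable `]0, +oo[ (EFin \o (fun t => r * Re (f t))).
  exact: (integrableZl mD r f1).
have i2 (r : R) : mu.-integrable `]0, +oo[ (EFin \o (fun t => r * Im (f t))).
  exact: (integrableZl mD r f2).
apply: complex_eqP; rewrite ?(ReM, ImM)/=.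
- rewrite -(RintegralZl _ mD f1) -(RintegralZl _ mD f2) -(RintegralB mD (i1 _) (i2 _)).
  by apply: eq_Rintegral => t _ /=; rewrite ReM.
- rewrite -(RintegralZl _ mD f1) -(RintegralZl _ mD f2) -(RintegralD mD (i2 _) (i1 _)).
  by apply: eq_Rintegral => t _ /=; rewrite ImM.
Qed.

Lemma cintegrable_dominated f (K c : R) : 0 < c ->
  (forall t, 0 < t -> ccontinuous_at f t) ->
  (forall t, 0 < t -> cabs (f t) <= K * expR (- c * t)) -> cintegrable f.
Proof.
move=> c0 cf bf; split; apply: (continuous_integrable_dominated c0).
- by move=> t /cf[].
- by move=> t t0; apply: le_trans (bf _ t0); exact: Re_le_cabs.
- by move=> t /cf[].
- by move=> t t0; apply: le_trans (bf _ t0); exact: Im_le_cabs.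
Qed.

Lemma cintegral_derive_eq0 F f (K : R) :
  (forall t, 0 < t -> is_cderive F t (f t)) ->
  (forall t, 0 < t -> ccontinuous_at f t) ->
  cintegrable f ->
  (forall t, 0 < t -> cabs (F t) <= K * t) ->
  (forall t, 0 < t -> cabs (F t) <= K / t) ->
  cintegral `]0, +oo[ f = 0.
Proof.
move=> dF cf [f1 f2] F0 Foo; apply: complex_eqP => /=.
- apply: (@Rintegral_derive_eq0 _ (Re \o F) _ K) => // t t0.
  + by have [] := dF _ t0.
  + by have [] := cf _ t0.
  + by apply: le_trans (F0 _ t0); exact: Re_le_cabs.
  + by apply: le_trans (Foo _ t0); exact: Re_le_cabs.
- apply: (@Rintegral_derive_eq0 _ (Im \o F) _ K) => // t t0.
  + by have [] := dF _ t0.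
  + by have [] := cf _ t0.
  + by apply: le_trans (F0 _ t0); exact: Im_le_cabs.
  + by apply: le_trans (Foo _ t0); exact: Im_le_cabs.
Qed.

End complex_calculus.

(** * Mellin-Laplace integrals: convergence, linearity, integration by parts *)

Section mellin_transform.
Context {R : realType}.
Local Notation C := R[i].
Local Notation Re := (@complex.Re R).
Local Notation Im := (@complex.Im R).
Local Notation cabs := (@ComplexField.Normc.normc R).
Implicit Types (phi psi : R -> R) (t : R) (x w z : C) (n : nat).

(* A pole of order at most [n] at 0 and polynomial growth at infinity. *)
Definition tame n phi :=
  (forall t, 0 < t -> {for t, continuous phi}) /\
  exists K m, 0 <= K /\
    forall t, 0 < t -> `|phi t| <= K * ((1 + t) ^+ m / t ^+ n).

Lemma tame_cst (a : R) : tame 0 (fun=> a).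
Proof.
split=> [t _|]; first exact: cst_continuous.
by exists `|a|, 0%N; split => // t _; rewrite expr0 divr1 mulr1.
Qed.

Lemma tameD n phi psi : tame n phi -> tame n psi ->
  tame n (fun t => phi t + psi t).
Proof.
move=> [cp [K [m [K0 bp]]]] [cq [L [l [L0 bq]]]]; split=> [t t0|].
  by apply: continuousD; [exact: cp|exact: cq].
exists (K + L), (m + l)%N; split=> [|t t0]; first exact: addr_ge0.
apply: le_trans (ler_normD _ _) _; rewrite mulrDl; apply: lerD.
  apply: le_trans (bp _ t0) _; rewrite ler_wpM2l// ler_wpM2r//.
    by rewrite invr_ge0 exprn_ge0 ?ltW.
  by rewrite ler_weXn2l ?leq_addr// lerDl ltW.
apply: le_trans (bq _ t0) _; rewrite ler_wpM2l// ler_wpM2r//.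
  by rewrite invr_ge0 exprn_ge0 ?ltW.
by rewrite ler_weXn2l ?leq_addl// lerDl ltW.
Qed.

Lemma tameM n n' phi psi : tame n phi -> tame n' psi ->
  tame (n + n') (fun t => phi t * psi t).
Proof.
move=> [cp [K [m [K0 bp]]]] [cq [L [l [L0 bq]]]]; split=> [t t0|].
  by apply: continuousM; [exact: cp|exact: cq].
exists (K * L), (m + l)%N; split=> [|t t0]; first exact: mulr_ge0.
have -> : K * L * ((1 + t) ^+ (m + l) / t ^+ (n + n')) =
    K * ((1 + t) ^+ m / t ^+ n) * (L * ((1 + t) ^+ l / t ^+ n')).
  by rewrite !exprD invfM; ring.
by rewrite normrM ler_pM// ?bp ?bq.
Qed.

Lemma tameZ n (a : R) phi : tame n phi -> tame n (fun t => a * phi t).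
Proof. exact: (tameM (tame_cst a)). Qed.

Lemma tame_mul_id n phi : tame n.+1 phi -> tame n (fun t => t * phi t).
Proof.
move=> [cp [K [m [K0 bp]]]]; split=> [t t0|].
  by apply: continuousM; [exact: id|exact: cp].
exists K, m; split=> // t t0; rewrite normrM gtr0_norm//.
apply: le_trans (ler_wpM2l (ltW t0) (bp _ t0)) _.
by rewrite exprS invfM mulrCA (mulrCA t) mulVKf ?gt_eqF.
Qed.

(** The bound is multiplied by ((1 + t) / t)^(n' - n), which is at least 1; the growth exponent
    rises together with the pole order. *)
Lemma tameW n n' phi : (n <= n')%N -> tame n phi -> tame n' phi.
Proof.
move=> nn' [cp [K [m [K0 bp]]]]; split=> //.
exists K, (m + (n' - n))%N; split=> // t t0.
apply: le_trans (bp _ t0) _; rewrite ler_wpM2l//.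
rewrite -{2}(subnKC nn') !exprD invfM mulrACA ler_peMr//.
  by rewrite divr_ge0 ?exprn_ge0 ?addr_ge0 ?ltW.
rewrite -expr_div_n exprn_ege1// ler_pdivlMr// mul1r.
by rewrite lerDr.
Qed.

Lemma tameX n phi k : tame n phi -> tame (k * n) (fun t => phi t ^+ k).
Proof.
move=> tp; elim: k => [|k IH]; first exact: (tame_cst 1).
rewrite mulSn; under eq_fun do rewrite exprS; exact: tameM.
Qed.

Lemma tame_sum n (r : seq nat) (F : nat -> R -> R) :
  (forall i, i \in r -> tame n (F i)) -> tame n (fun t => \sum_(i <- r) F i t).
Proof.
elim: r => [|i r IH] tF.
  by under eq_fun do rewrite big_nil; apply: tameW (tame_cst 0).
under eq_fun do rewrite big_cons.
apply: tameD; first by apply: tF; rewrite mem_head.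
by apply: IH => j jr; apply: tF; rewrite in_cons jr orbT.
Qed.

(** The weight is t^w rather than t^(w-1): the integrals of [Z] and of [Gamma] at [s] correspond to
    [w = s - 1]. *)
Definition mellin_term x w phi t : C :=
  cpow t%:C w * (phi t)%:C * cexp (- x * t%:C).

Definition mellin x w phi : C := cintegral `]0, +oo[ (mellin_term x w phi).

(** From ln y <= y - 1 at y = (1 + t) c / D one gets D ln(1 + t) <= c t + (c - D - D ln(c / D)); the
    constant part is the logarithm of the witness. The summand 1 in [D] keeps it positive when [d]
    and [m] are 0. *)
Lemma expR_dominates (d c : R) m : 0 <= d -> 0 < c ->
  exists2 K, 0 <= K & forall t, 0 < t ->
    expR (d * ln t) * (1 + t) ^+ m <= K * expR (c * t).
Proof.
move=> d0 c0; pose D := d + m%:R + 1.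
have D0 : 0 < D by rewrite /D ltr_wpDl// addr_ge0.
exists (expR (c - D - D * ln (c / D))); first exact: expR_ge0.
move=> t t0; have t1 : 0 < 1 + t by rewrite addr_gt0.
have l1 : 0 <= ln (1 + t) by rewrite ln_ge0// lerDl ltW.
have -> : (1 + t) ^+ m = expR (m%:R * ln (1 + t)).
  by rewrite expRM_natl lnK ?posrE.
rewrite -!expRD ler_expR.
have h1 : d * ln t <= d * ln (1 + t).
  by rewrite ler_wpM2l// ler_ln ?posrE// lerDr.
have y0 : 0 < (1 + t) * (c / D) by rewrite mulr_gt0// divr_gt0.
have h2 : ln ((1 + t) * (c / D)) <= (1 + t) * (c / D) - 1.
  by rewrite -{1}[_ * (c / D)](addrNK 1) addrC le_ln1Dx// ltrBrDr addNr.
rewrite lnM ?posrE ?divr_gt0// in h2.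
have := ler_wpM2l (ltW D0) h2.
have -> : D * ((1 + t) * (c / D) - 1) = (1 + t) * c - D.
  by field; rewrite gt_eqF.
have h3 : (D - d - m%:R) * ln (1 + t) >= 0 by rewrite mulr_ge0// /D; lra.
by move=> h4; rewrite mulrDr in h4; lra.
Qed.

Lemma cabs_mellin_term phi x w t : 0 < t -> cabs (mellin_term x w phi t) =
  expR (Re w * ln t) * `|phi t| * expR (- Re x * t).
Proof.
move=> t0; rewrite /mellin_term !ComplexField.Normc.normcM cabs_cpow// cabs_real.
by rewrite cabs_cexp; congr (_ * expR _); rewrite ReM/= mulr0 subr0; case: x.
Qed.

(** Half of the decay rate Re x absorbs the growth of t^(Re w - n - d) (1 + t)^m, the other half
    survives. The free exponent [d] serves three purposes: 0 for integrability, 1 for the boundary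
    at 0, -1 for the boundary at infinity. *)
Lemma mellin_term_bound n phi x w (d : R) : tame n phi -> 0 < Re x ->
  n%:R + d <= Re w -> exists2 K, 0 <= K & forall t, 0 < t ->
    cabs (mellin_term x w phi t) <=
    K * (expR (d * ln t) * expR (- (Re x / 2) * t)).
Proof.
move=> [_ [K [m [K0 bp]]]] x0 hw.
have [L L0 HL] := @expR_dominates (Re w - n%:R - d) (Re x / 2) m
  ltac:(lra) ltac:(lra).
exists (K * L) => [|t t0]; first exact: mulr_ge0.
rewrite cabs_mellin_term//.
have -> : expR (Re w * ln t) =
    expR ((Re w - n%:R - d) * ln t) * expR (d * ln t) * t ^+ n.
  have -> : t ^+ n = expR (n%:R * ln t) by rewrite expRM_natl lnK ?posrE.
  by rewrite -!expRD; congr expR; ring.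
have -> : expR (- Re x * t) = expR (- (Re x / 2) * t) * expR (- (Re x / 2) * t).
  by rewrite -expRD; congr expR; field.
have -> : K * L * (expR (d * ln t) * expR (- (Re x / 2) * t)) =
  K * (L * expR (Re x / 2 * t)) * expR (d * ln t)
    * (expR (- (Re x / 2) * t) * expR (- (Re x / 2) * t)).
  have := expRxMexpNx_1 (Re x / 2 * t); rewrite -mulNr => e.
  transitivity (K * L * (expR (d * ln t) * expR (- (Re x / 2) * t)) *
     (expR (Re x / 2 * t) * expR (- (Re x / 2) * t))); last by ring.
  by rewrite e mulr1.
rewrite ler_wpM2r ?mulr_ge0 ?expR_ge0//.
have := ler_wpM2l K0 (HL _ t0) => h.
have := ler_wpM2r (expR_ge0 (d * ln t)) h; apply: le_trans.
have tn : 0 < t ^+ n by rewrite exprn_gt0.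
apply: le_trans (ler_wpM2l _ (bp _ t0)) _.
  by rewrite !mulr_ge0 ?expR_ge0 ?ltW.
by rewrite le_eqVlt; apply/orP; left; apply/eqP; field; rewrite gt_eqF.
Qed.

Lemma is_cderive_cexp_linear x t :
  is_cderive (fun t => cexp (- x * t%:C)) t (- x * cexp (- x * t%:C)).
Proof.
have h : is_cderive (fun t => - x * t%:C) t (- x).
  have := is_cderiveM (is_cderive_cst (- x) t)
    (is_cderive_real (is_derive_id t (1 : R))).
  by rewrite mul0r add0r mulr1.
exact: is_cderive_cexp h.
Qed.

Lemma mellin_term_derive phi psi x w t : 0 < t -> is_derive t 1 phi (psi t) ->
  is_cderive (mellin_term x w phi) t
    (w * mellin_term x (w - 1) phi t +
     (mellin_term x w psi t + - x * mellin_term x w phi t)).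
Proof.
move=> t0 dp; have h := is_cderiveM (is_cderiveM (is_cderive_cpow w t0)
  (is_cderive_real dp)) (is_cderive_cexp_linear x t).
rewrite (_ : _ + _ = (w * cpow t%:C (w - 1) * (phi t)%:C + cpow t%:C w * (psi t)%:C)
  * cexp (- x * t%:C) + cpow t%:C w * (phi t)%:C * (- x * cexp (- x * t%:C)))//.
by rewrite /mellin_term; ring.
Qed.

Lemma ccontinuousM (f g : R -> C) t : ccontinuous_at f t -> ccontinuous_at g t ->
  ccontinuous_at (fun t => f t * g t) t.
Proof.
move=> [f1 f2] [g1 g2]; split.
- rewrite (_ : Re \o _ = (Re \o f) * (Re \o g) - (Im \o f) * (Im \o g)).
    by apply: continuousB; apply: continuousM.
  by apply/funext => u /=; rewrite ReM.
- rewrite (_ : Im \o _ = (Re \o f) * (Im \o g) + (Im \o f) * (Re \o g)).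
    by apply: continuousD; apply: continuousM.
  by apply/funext => u /=; rewrite ImM.
Qed.

Lemma ccontinuousD (f g : R -> C) t : ccontinuous_at f t -> ccontinuous_at g t ->
  ccontinuous_at (fun t => f t + g t) t.
Proof.
move=> [f1 f2] [g1 g2]; split.
- rewrite (_ : Re \o _ = (Re \o f) + (Re \o g)); first exact: continuousD.
  by apply/funext => u /=; rewrite ReD.
- rewrite (_ : Im \o _ = (Im \o f) + (Im \o g)); first exact: continuousD.
  by apply/funext => u /=; rewrite ImD.
Qed.

Lemma ccontinuousZ z (f : R -> C) t : ccontinuous_at f t ->
  ccontinuous_at (fun t => z * f t) t.
Proof.
by apply: ccontinuousM; exact: is_cderive_continuous (is_cderive_cst z t).
Qed.

Lemma mellin_term_continuous phi x w t : 0 < t -> {for t, continuous phi} ->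
  ccontinuous_at (mellin_term x w phi) t.
Proof.
move=> t0 cp; apply: ccontinuousM; last first.
  exact: is_cderive_continuous (is_cderive_cexp_linear x t).
apply: ccontinuousM; first exact: is_cderive_continuous (is_cderive_cpow w t0).
by split => //; exact: cst_continuous.
Qed.

Lemma mellin_term_integrable n phi x w : tame n phi -> 0 < Re x ->
  n%:R <= Re w -> cintegrable (mellin_term x w phi).
Proof.
move=> tp x0 hw; have [K K0 HK] := @mellin_term_bound n phi x w 0 tp x0
  ltac:(by rewrite addr0).
apply: (@cintegrable_dominated _ _ K (Re x / 2)); first lra.
  by move=> t t0; apply: mellin_term_continuous => //; apply: tp.1.
by move=> t t0; have := HK _ t0; rewrite mul0r expR0 mul1r.
Qed.

Lemma mellinD n x w phi psi : tame n phi -> tame n psi -> 0 < Re x ->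
  n%:R <= Re w ->
  mellin x w (fun t => phi t + psi t) = mellin x w phi + mellin x w psi.
Proof.
move=> tp tq x0 hw; rewrite -cintegralD; try exact: mellin_term_integrable hw.
by apply: eq_cintegral => t t0; rewrite /mellin_term rmorphD/=; ring.
Qed.

Lemma mellinZ n x w (a : R) phi : tame n phi -> 0 < Re x -> n%:R <= Re w ->
  mellin x w (fun t => a * phi t) = a%:C * mellin x w phi.
Proof.
move=> tp x0 hw; rewrite -cintegralZ; last exact: mellin_term_integrable hw.
by apply: eq_cintegral => t t0; rewrite /mellin_term rmorphM/=; ring.
Qed.

Lemma eq_mellin x w phi psi : (forall t, 0 < t -> phi t = psi t) ->
  mellin x w phi = mellin x w psi.
Proof.
by move=> e; apply: eq_cintegral => t t0; rewrite /mellin_term e.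
Qed.

Lemma mellin_sum n x w (r : seq nat) (F : nat -> R -> R) :
  (forall i, i \in r -> tame n (F i)) -> 0 < Re x -> n%:R <= Re w ->
  mellin x w (fun t => \sum_(i <- r) F i t) = \sum_(i <- r) mellin x w (F i).
Proof.
move=> + x0 hw; elim: r => [|i r IH] tF.
  rewrite big_nil -[RHS](mul0r (mellin x w (fun=> 0))).
  rewrite -(mellinZ 0 _ x0 hw); last exact: tameW (tame_cst 0).
  by apply: eq_mellin => t _; rewrite big_nil mul0r.
rewrite big_cons -IH; last by move=> j jr; apply: tF; rewrite in_cons jr orbT.
rewrite -(@mellinD n)//; first by apply: eq_mellin => t _; rewrite big_cons.
  by apply: tF; rewrite mem_head.
by apply: tame_sum => j jr; apply: tF; rewrite in_cons jr orbT.
Qed.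

Lemma mellin_mul_id x w phi : mellin x w (fun t => t * phi t) = mellin x (w + 1) phi.
Proof.
apply: eq_cintegral => t t0.
by rewrite /mellin_term cpowD// (cpow1 t0) rmorphM/=; ring.
Qed.

(** The derivative of t^w phi(t) e^(-xt) has integral 0. The condition on Re w makes the term with
    exponent [w - 1] converge and gives the antiderivative the order O(t) at 0. *)
Lemma mellin_by_parts n phi psi x w : tame n phi -> tame n.+1 psi ->
  (forall t, 0 < t -> is_derive t 1 phi (psi t)) -> 0 < Re x ->
  n.+1%:R <= Re w ->
  w * mellin x (w - 1) phi + mellin x w psi = x * mellin x w phi.
Proof.
move=> tp tq dp x0 hw.
have hw1 : n%:R <= Re w by apply: le_trans hw; rewrite ler_nat.
have hw2 : n%:R <= Re (w - 1).
  by rewrite ReD/= lerBrDr natr1.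
have i1 := mellin_term_integrable tp x0 hw2.
have i2 := mellin_term_integrable tq x0 hw.
have i3 := mellin_term_integrable tp x0 hw1.
have [K K0 HK] := @mellin_term_bound n phi x w 1 tp x0
  ltac:(by rewrite natr1).
have [L L0 HL] := @mellin_term_bound n phi x w (-1) tp x0
  ltac:(by apply: le_trans hw1; rewrite gerDl lerN10).
have E t : 0 < t -> expR (- (Re x / 2) * t) <= 1.
  by move=> t0; rewrite expR_le1// mulNr oppr_le0 mulr_ge0 ?divr_ge0 ?ltW.
have : cintegral `]0, +oo[ (fun t => w * mellin_term x (w - 1) phi t +
     (mellin_term x w psi t + - x * mellin_term x w phi t)) = 0.
  apply: (@cintegral_derive_eq0 _ (mellin_term x w phi) _ (K + L)).
  - by move=> t t0; apply: mellin_term_derive => //; exact: dp.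
  - move=> t t0; apply: ccontinuousD.
      by apply: ccontinuousZ; apply: mellin_term_continuous => //; exact: tp.1.
    apply: ccontinuousD.
      by apply: mellin_term_continuous => //; exact: tq.1.
    by apply: ccontinuousZ; apply: mellin_term_continuous => //; exact: tp.1.
  - exact: cintegrableD (cintegrableZ w i1) (cintegrableD i2 (cintegrableZ (- x) i3)).
  - move=> t t0; apply: le_trans (HK _ t0) _; rewrite mul1r lnK ?posrE//.
    have h1 := ler_wpM2l (mulr_ge0 K0 (ltW t0)) (E _ t0).
    have h2 := mulr_ge0 L0 (ltW t0); rewrite mulrA; lra.
  - move=> t t0; apply: le_trans (HL _ t0) _.
    rewrite mulN1r expRN lnK ?posrE//.
    have h1 := ler_wpM2l (divr_ge0 L0 (ltW t0)) (E _ t0).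
    have h2 := divr_ge0 K0 (ltW t0); rewrite mulrA; lra.
rewrite (cintegralD (cintegrableZ w i1) (cintegrableD i2 (cintegrableZ (- x) i3))).
rewrite (cintegralZ _ i1) (cintegralD i2 (cintegrableZ (- x) i3)) (cintegralZ _ i3).
by rewrite addrA mulNr => /eqP; rewrite subr_eq0 => /eqP.
Qed.

Lemma GammaE s : Gamma s = mellin 1 (s - 1) (fun=> 1).
Proof.
apply: eq_cintegral => t t0; rewrite /mellin_term mulr1.
by congr (_ * cexp _); rewrite mulN1r.
Qed.

(** At [x = 1] this is the functional equation of Gamma; at other [x] it supplies the cancellation
    along the path z^u in [mellin_power]. *)
Lemma mellin1_by_parts x w : 0 < Re x -> 1 <= Re w ->
  w * mellin x (w - 1) (fun=> 1) = x * mellin x w (fun=> 1).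
Proof.
move=> x0 hw.
have := @mellin_by_parts 0 (fun=> 1) (fun=> 0) x w (tame_cst 1)
  (tameW (leq0n _) (tame_cst 0)) (fun t _ => is_derive_cst (1 : R) t (1 : R)) x0 hw.
move=> <-; have -> : mellin x w (fun=> 0) = 0; last by rewrite addr0.
transitivity (mellin x w (fun=> 0 * 1)).
  by apply: eq_mellin => t _; rewrite mul0r.
by rewrite (mellinZ 0 (tame_cst 1))// ?rmorph0 ?mul0r// (le_trans ler01).
Qed.

Lemma GammaD1 s : 1 <= Re s -> Gamma (s + 1) = s * Gamma s.
Proof.
by move=> hs; rewrite !GammaE addrK (@mellin1_by_parts 1 s)// mul1r.
Qed.

End mellin_transform.

(** * Derivatives of G and the iterated integration by parts *)

Section derivatives_of_G.
Context {R : realType}.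
Local Notation C := R[i].
Local Notation Re := (@complex.Re R).
Implicit Types (t : R) (x w : C).

Definition geo t : R := (1 - expR (- t))^-1.

Lemma geo_den_gt0 t : 0 < t -> 0 < 1 - expR (- t).
Proof. by move=> t0; rewrite subr_gt0 expR_lt1 oppr_lt0. Qed.

Lemma is_derive_geo t : 0 < t -> is_derive t 1 geo (geo t - geo t ^+ 2).
Proof.
move=> t0; have d0 := geo_den_gt0 t0.
have h1 : is_derive t 1 (fun t => 1 - expR (- t)) (expR (- t)).
  have h := is_derive1_comp (is_derive_expR (- t)) (is_deriveN (is_derive_id t (1 : R))).
  apply: is_derive_eq (is_deriveB (is_derive_cst (1 : R) t (1 : R)) h) _.
  by ring.
have nz : 1 - expR (- t) != 0 by rewrite gt_eqF.
have h : is_derive t 1 geo (- (1 - expR (- t)) ^- 2 *: expR (- t)).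
  exact: (@is_deriveV R (fun t => 1 - expR (- t)) t _ _ nz h1).
apply: (is_derive_eq h); rewrite /geo /GRing.scale/=.
by field; rewrite gt_eqF.
Qed.

(** The bound (1 + t) / t is equivalent to (1 + t) e^(-t) <= 1. *)
Lemma tame_geo : tame 1 geo.
Proof.
split=> [t t0|]; first exact: is_derive_continuous (is_derive_geo t0).
exists 1, 1%N; split => // t t0; have d0 := geo_den_gt0 t0.
have g0 : 0 <= geo t by rewrite invr_ge0 ltW.
rewrite (ger0_norm g0) mul1r !expr1 /geo -[leLHS]mul1r ler_pdivrMr// mulrAC ler_pdivlMr//.
have : (1 + t) * expR (- t) <= 1.
  rewrite expRN ler_pdivrMr ?expR_gt0// mul1r; exact: expR_ge1Dx.
lra.
Qed.

(** Coefficient of f^(i+1) in the [a]-th derivative of f. Because f^(i+1) has derivative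
    (i+1)(f^(i+1) - f^(i+2)), these coefficients satisfy the Stirling recurrence up to sign and
    factorial. *)
Definition dgeo_coef (a i : nat) : R :=
  (-1) ^+ i * i`!%:R * (stirling2 a.+1 i.+1)%:R.

Definition dgeo (a : nat) t : R :=
  \sum_(0 <= i < a.+1) dgeo_coef a i * geo t ^+ i.+1.

Lemma stirling2_gt n j : (n < j)%N -> stirling2 n j = 0%N.
Proof.
elim: n j => [|n IH] [|j]//= nj.
by rewrite !IH ?muln0//; apply: ltnW.
Qed.

Lemma dgeo_coef_gt a i : (a < i)%N -> dgeo_coef a i = 0.
Proof. by move=> ai; rewrite /dgeo_coef stirling2_gt ?mulr0. Qed.

Lemma dgeo_coefS0 a : dgeo_coef a.+1 0 = dgeo_coef a 0.
Proof.
by rewrite /dgeo_coef; congr (_ * _%:R); rewrite /= !mul1n !addn0.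
Qed.

Lemma dgeo_coefSS a i : dgeo_coef a.+1 i.+1 =
  i.+2%:R * dgeo_coef a i.+1 - i.+1%:R * dgeo_coef a i.
Proof.
rewrite /dgeo_coef.
have -> : stirling2 a.+2 i.+2 = (i.+2 * stirling2 a.+1 i.+2 + stirling2 a.+1 i.+1)%N.
  by [].
by rewrite natrD natrM factS natrM exprS; ring.
Qed.

Lemma is_derive_sum_seq (r : seq nat) (F : nat -> R -> R) (d : nat -> R) t :
  (forall i, is_derive t 1 (F i) (d i)) ->
  is_derive t 1 (fun t => \sum_(i <- r) F i t) (\sum_(i <- r) d i).
Proof.
move=> dF; elim: r => [|i r IH].
  rewrite big_nil (_ : (fun t => _) = cst 0); first exact: is_derive_cst.
  by apply/funext => u; rewrite big_nil.
rewrite big_cons (_ : (fun t => _) = F i + (fun t => \sum_(i <- r) F i t)).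
  exact: is_deriveD.
by apply/funext => u; rewrite big_cons.
Qed.

Lemma is_derive_dgeo a t : 0 < t -> is_derive t 1 (dgeo a) (dgeo a.+1 t).
Proof.
move=> t0; have dg := is_derive_geo t0.
have H i : is_derive t 1 (fun t => dgeo_coef a i * geo t ^+ i.+1)
    (i.+1%:R * dgeo_coef a i * (geo t ^+ i.+1 - geo t ^+ i.+2)).
  have h := is_deriveM (is_derive_cst (dgeo_coef a i) t (1 : R)) (is_deriveX i.+1 dg).
  rewrite (_ : (fun t => _) = cst (dgeo_coef a i) * geo ^+ i.+1).
    apply: is_derive_eq h _.
    by rewrite /GRing.scale/= mulr0 addr0 !exprS; ring.
  by apply/funext => u; rewrite !fctE.
apply: is_derive_eq (is_derive_sum_seq _ H) _.
rewrite /dgeo [in RHS]big_nat_recl//.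
under [in RHS]eq_big_nat => i _ do rewrite dgeo_coefSS mulrBl.
rewrite sumrB dgeo_coefS0 addrA.
under eq_bigr => i _ do rewrite mulrBr.
rewrite sumrB; congr (_ - _).
(* The split-off term and the shifted sum form one sum over [i < a.+2], whose top term vanishes
   because S(a+1, a+2) = 0. *)
rewrite [RHS](_ : _ = \sum_(0 <= i < a.+2) i.+1%:R * dgeo_coef a i * geo t ^+ i.+1).
  by rewrite [RHS]big_nat_recr//= dgeo_coef_gt// mulr0 mul0r addr0.
by rewrite [RHS]big_nat_recl//= mul1r.
Qed.

Lemma tame_dgeo a : tame a.+1 (dgeo a).
Proof.
apply: tame_sum => i; rewrite mem_index_iota => /andP[_ ia].
apply: tameZ; apply: (@tameW _ i.+1) => //.
by have := @tameX _ _ _ i.+1 tame_geo; rewrite muln1.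
Qed.

(** Leibniz's rule for the [p]-th derivative of t f(t) on t > 0. At [p = 0] the factor [p%:R]
    removes the term with the truncated predecessor. *)
Definition dG (p : nat) t : R := t * dgeo p t + p%:R * dgeo p.-1 t.

Lemma is_derive_dG p t : 0 < t -> is_derive t 1 (dG p) (dG p.+1 t).
Proof.
move=> t0.
have h := is_deriveD (is_deriveM (is_derive_id t (1 : R)) (is_derive_dgeo p t0))
  (is_deriveM (is_derive_cst (p%:R : R) t (1 : R)) (is_derive_dgeo p.-1 t0)).
apply: is_derive_eq h _; rewrite /dG /GRing.scale/= !mulr0 addr0 mulr1.
by case: p => [|p]/=; [rewrite !mul0r mul1r addr0|rewrite -!natr1; ring].
Qed.

Lemma tame_dG p : tame p (dG p).
Proof.
apply: tameD; first by apply: tame_mul_id; exact: tame_dgeo.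
case: p => [|p]; last by apply: tameZ; exact: tame_dgeo.
by under eq_fun do rewrite mul0r; exact: tame_cst.
Qed.

Lemma dG0 t : dG 0 t = t * geo t.
Proof.
rewrite /dG mul0r addr0 /dgeo big_nat1 /dgeo_coef.
by rewrite expr0 expr1 /= !mul1r.
Qed.

Lemma derive1n_G p t : 0 < t -> derive1n p (@G R) t = dG p t.
Proof.
elim: p t => [|p IH] t t0.
  by rewrite derive1n0 dG0 /G gt_eqF.
rewrite derive1nS derive1E.
have : is_derive t 1 (derive1n p (@G R)) (dG p.+1 t).
  (* The induction hypothesis holds for positive arguments only, which form a neighbourhood of
     [t]. *)
  apply: is_derive_near_eq (is_derive_dG p t0).
  by near=> u; rewrite IH//; near: u; exact: lt_nbhsr.
by case.
Unshelve. all: by end_near. Qed.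

Definition mellin_dG x w p q : C := mellin x w (fun t => dG p t * dG q t).

(** One integration by parts: the derivative removed from the second factor falls on the first
    factor, on e^(-xt), or on t^w. *)
Lemma mellin_dGS x w p q : 0 < Re x -> (p + q).+1%:R <= Re w ->
  mellin_dG x w p q.+1 =
  - (mellin_dG x w p.+1 q + (- x * mellin_dG x w p q + w * mellin_dG x (w - 1) p q)).
Proof.
move=> x0 hw.
have t1 : tame (p + q).+1 (fun t => dG p.+1 t * dG q t).
  by rewrite -addSn; apply: tameM; exact: tame_dG.
have t2 : tame (p + q).+1 (fun t => dG p t * dG q.+1 t).
  by rewrite -addnS; apply: tameM; exact: tame_dG.
have := @mellin_by_parts _ (p + q) (fun t => dG p t * dG q t)
  (fun t => dG p.+1 t * dG q t + dG p t * dG q.+1 t) x w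
  (tameM (tame_dG p) (tame_dG q)) (tameD t1 t2).
rewrite (mellinD t1 t2)// => /(_ _ x0 hw) H.
have {}H : w * mellin_dG x (w - 1) p q + (mellin_dG x w p.+1 q + mellin_dG x w p q.+1)
   = x * mellin_dG x w p q.
  apply: H => t t0.
  have h := is_deriveM (is_derive_dG p t0) (is_derive_dG q t0).
  by apply: is_derive_eq h _; rewrite /GRing.scale/=; ring.
by rewrite mulNr -H; ring.
Qed.

Lemma binomial_sumS (F : nat -> C) q :
  \sum_(0 <= i < q.+2) 'C(q.+1, i)%:R * F i =
  \sum_(0 <= i < q.+1) 'C(q, i)%:R * F i +
  \sum_(0 <= i < q.+1) 'C(q, i)%:R * F i.+1.
Proof.
rewrite big_nat_recl//.
under eq_bigr => i _ do rewrite binS natrD mulrDl.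
rewrite big_split/= addrA; congr (_ + _).
rewrite bin0 -(bin0 q) -(@big_nat_recl _ _ _ _ _ (fun i => 'C(q, i)%:R * F i))//.
by rewrite big_nat_recr//= bin_small// mul0r addr0.
Qed.

Definition falling w k : C := \prod_(0 <= l < k) (w - l%:R).

Lemma fallingS w k : falling w k.+1 = w * falling (w - 1) k.
Proof.
rewrite /falling big_nat_recl// subr0; congr (_ * _).
by apply: eq_bigr => l _; rewrite -natr1 opprD [- l%:R - 1]addrC addrA.
Qed.

(** The operator g(w) |-> -x g(w) + w g(w - 1), applied [i] times to the integral with no derivative
    left on the second factor; [k] counts how often the exponent is lowered. *)
Definition by_parts_iter x w p i : C :=
  \sum_(0 <= k < i.+1) 'C(i, k)%:R *
     ((- x) ^+ (i - k) * falling w k * mellin_dG x (w - k%:R) p 0).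

Lemma by_parts_iterS x w p i : by_parts_iter x w p i.+1 =
  - x * by_parts_iter x w p i + w * by_parts_iter x (w - 1) p i.
Proof.
rewrite /by_parts_iter binomial_sumS !big_distrr/=; congr (_ + _).
  apply: eq_big_nat => k /andP[_ ki].
  by rewrite subSn// exprS; ring.
apply: eq_bigr => k _; rewrite subSS fallingS.
by rewrite -natr1 opprD [- k%:R - 1]addrC addrA; ring.
Qed.

(** Raising the derivative order [p] commutes with the operator of [by_parts_iter], so [q] steps
    expand binomially: [i] of them act on the exponential and the power, the other [q - i] on the
    first factor. *)
Lemma mellin_dG_expand x w p q : 0 < Re x -> (p + q)%:R <= Re w ->
  mellin_dG x w p q = (-1) ^+ q *
    \sum_(0 <= i < q.+1) 'C(q, i)%:R * by_parts_iter x w (p + q - i) i.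
Proof.
move=> x0; elim: q w p => [|q IH] w p hw.
  rewrite expr0 mul1r big_nat1 bin0 mul1r /by_parts_iter big_nat1 bin0.
  by rewrite /falling big_nil !expr0 !mul1r subr0 subn0 addn0.
rewrite mellin_dGS//; last by rewrite -addnS.
rewrite !IH//; last 3 first.
- by rewrite ReD/= lerBrDr natr1 -addnS.
- by apply: le_trans hw; rewrite ler_nat; lia.
- by rewrite addSnnS.
rewrite binomial_sumS exprS -!mulrA mulN1r; congr (- _).
have e (r a b c : C) :
    r * a + (- x * (r * b) + w * (r * c)) = r * (a + (- x * b + w * c)) by ring.
rewrite e; congr (_ * (_ + _)).
  by apply: eq_bigr => i _; rewrite addSnnS.
rewrite !big_distrr -big_split/=; apply: eq_big_nat => i /andP[_ iq].
rewrite addnS subSS by_parts_iterS; ring.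
Qed.

End derivatives_of_G.

(** * The integral of t^(s-1) e^(-zt) for complex z *)

Section complex_powers.
Context {R : realType}.
Local Notation mu := (@lebesgue_measure R).
Local Notation C := R[i].
Local Notation Re := (@complex.Re R).
Local Notation Im := (@complex.Im R).
Local Notation cabs := (@ComplexField.Normc.normc R).
Implicit Types (t u : R) (w z s : C).

Let mD : measurable (`]0, +oo[%classic : set (measurableTypeR R)).
Proof. exact: measurable_itv. Qed.

Lemma is_derive_under_integral (h h' : R -> R -> R) (a b K c u : R) :
  0 < c -> 0 <= K -> a < u < b ->
  (forall v, a < v < b -> mu.-integrable `]0, +oo[ (EFin \o h v)) ->
  (forall v t, a < v < b -> 0 < t -> is_derive v 1 (h^~ t) (h' v t)) ->
  (forall v t, a < v < b -> 0 < t -> `|h' v t| <= K * expR (- c * t)) ->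
  is_derive u 1 (fun v => \int[mu]_(t in `]0, +oo[) h v t)
    (\int[mu]_(t in `]0, +oo[) h' u t).
Proof.
move=> c0 K0 uab hint hd hb.
have Iu : `]a, b[%classic u by rewrite /= in_itv.
have h1 v : `]a, b[%classic v -> mu.-integrable `]0, +oo[ (EFin \o h v).
  by rewrite /= in_itv/=; exact: hint.
have h2 v t : `]a, b[%classic v -> `]0, +oo[%classic t -> derivable (h^~ t) v 1.
  by rewrite /= !in_itv/= andbT => vab t0; have [] := hd _ _ vab t0.
have p v t : a < v < b -> 0 < t -> partial1of2 h v t = h' v t.
  by move=> vab t0; rewrite partial1of2E; have [] := hd _ _ vab t0.
have h3 t : 0 <= K * expR (- c * t) by rewrite mulr_ge0// expR_ge0.
have h4 : mu.-integrable `]0, +oo[ (EFin \o (fun t => K * expR (- c * t))).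
  exact: (integrableZl mD K (integrable_expRN c0)).
have h5 v t : `]a, b[%classic v -> `]0, +oo[%classic t ->
    `|partial1of2 h v t| <= K * expR (- c * t).
  by rewrite /= !in_itv/= andbT => vab t0; rewrite p// hb.
split; first exact: (derivable_under_integral mD Iu h1 h2 h3 h4 h5).
rewrite -derive1E (differentiation_under_integral mD Iu h1 h2 h3 h4 h5).
by apply: eq_Rintegral => t; rewrite inE/= in_itv/= andbT => t0; rewrite p.
Qed.

Lemma is_cderive_under_integral (h h' : R -> R -> C) (a b K c u : R) :
  0 < c -> 0 <= K -> a < u < b ->
  (forall v, a < v < b -> cintegrable (h v)) ->
  (forall v t, a < v < b -> 0 < t -> is_cderive (h^~ t) v (h' v t)) ->
  (forall v t, a < v < b -> 0 < t -> cabs (h' v t) <= K * expR (- c * t)) ->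
  is_cderive (fun v => cintegral `]0, +oo[ (h v)) u (cintegral `]0, +oo[ (h' u)).
Proof.
move=> c0 K0 uab hint hd hb; split.
- apply: (@is_derive_under_integral (fun v t => Re (h v t))
    (fun v t => Re (h' v t)) a b K c) => // [v /hint[]//|v t vab t0|v t vab t0].
  + by have [] := hd _ _ vab t0.
  + by apply: le_trans (hb _ _ vab t0); exact: Re_le_cabs.
- apply: (@is_derive_under_integral (fun v t => Im (h v t))
    (fun v t => Im (h' v t)) a b K c) => // [v /hint[]//|v t vab t0|v t vab t0].
  + by have [] := hd _ _ vab t0.
  + by apply: le_trans (hb _ _ vab t0); exact: Im_le_cabs.
Qed.

Lemma is_cderive0_eq (f : R -> C) (a b : R) : a < b ->
  (forall u, a <= u <= b -> is_cderive f u 0) -> f a = f b.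
Proof.
move=> ab df; apply: complex_eqP; apply/esym/eqP; rewrite -subr_eq0; apply/eqP.
- have [| |c _] := @MVT _ (Re \o f) (fun=> 0) _ _ ab.
  + move=> u; rewrite in_itv/= => /andP[au ub].
    by have [] := df u ltac:(by rewrite !ltW).
  + apply: continuous_in_subspaceT => u; rewrite inE/= in_itv/= => /df.
    by case/is_cderive_continuous.
  + by rewrite mul0r.
- have [| |c _] := @MVT _ (Im \o f) (fun=> 0) _ _ ab.
  + move=> u; rewrite in_itv/= => /andP[au ub].
    by have [] := df u ltac:(by rewrite !ltW).
  + apply: continuous_in_subspaceT => u; rewrite inE/= in_itv/= => /df.
    by case/is_cderive_continuous.
  + by rewrite mul0r.
Qed.

(** A positive real part makes the cosine of the argument positive. The strict inequality leaves the
    margin needed to continue the path z^u slightly beyond both ends of [0, 1]. *)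
Lemma clogK_carg z : 0 < Re z ->
  cexp (clog z) = z /\ `|carg z| < pi / 2.
Proof.
move=> z0; have r0 : 0 < cabs z.
  by apply: lt_le_trans (Re_le_cabs z); rewrite normr_gt0 gt_eqF.
set y := Re z / cabs z.
have y0 : 0 < y by rewrite divr_gt0.
have y1 : y <= 1.
  by rewrite ler_pdivrMr// mul1r; apply: le_trans (Re_le_cabs z); exact: ler_norm.
have yy : -1 <= y <= 1 by rewrite y1 andbT (le_trans _ (ltW y0))// lerN10.
have ca : cos (acos y) = y by rewrite acosK// in_itv.
have sa : sin (acos y) = `|Im z| / cabs z.
  rewrite sin_acos//.
  have -> : 1 - y ^+ 2 = (Im z / cabs z) ^+ 2.
    have rr : cabs z ^+ 2 = Re z ^+ 2 + Im z ^+ 2.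
      by case: (z) => a b /=; rewrite sqr_sqrtr// addr_ge0// sqr_ge0.
    apply: (@mulIf _ (cabs z ^+ 2)); first by rewrite expf_neq0// gt_eqF.
    rewrite mulrBl mul1r {1}rr -!exprMn !divfK ?gt_eqF//; ring.
  by rewrite sqrtr_sqr normrM normfV (gtr0_norm r0).
have a0 : 0 <= acos y by exact: acos_ge0.
have ap : acos y < pi / 2.
  rewrite ltNge; apply/negP => h.
  have api := acos_lepi yy.
  have : cos (acos y) <= 0.
    have -> : acos y = (acos y - pi / 2) + pi / 2 by rewrite subrK.
    rewrite cosDpihalf oppr_le0 sin_ge0_pi//; apply/andP; split; first lra.
    have := pi_ge0 R; lra.
  by rewrite ca leNgt y0.
split; last first.
  by rewrite /carg; case: ifP => _; rewrite ?normrN ger0_norm.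
apply: complex_eqP; rewrite /cexp /clog /carg /= lnK ?posrE// -/y; case: ifPn => h.
- by rewrite ca mulrC divfK ?gt_eqF.
- by rewrite cosN ca mulrC divfK ?gt_eqF.
- by rewrite sa mulrC divfK ?gt_eqF// ger0_norm.
- by rewrite sinN sa mulrN mulrC divfK ?gt_eqF// ltr0_norm ?opprK// ltNge.
Qed.

(** The uniform lower bound [c] on the real part provides a single majorant e^(-ct), up to
    polynomial factors, for differentiating under the integral on an open interval around [0, 1]. *)
Lemma cexp_path_bounds z : 0 < Re z -> exists d c M : R,
  [/\ 0 < d, 0 < c, 0 <= M & forall u, - d < u < 1 + d ->
    c <= Re (cexp (u%:C * clog z)) /\ cabs (cexp (u%:C * clog z)) <= M].
Proof.
move=> z0; have [_] := clogK_carg z0.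
set th := `|carg z| => th_lt; have th0 : 0 <= th by exact: normr_ge0.
have p0 := pi_gt0 R.
set l := ln (cabs z).
(* This [d] makes (1 + d) th at most the midpoint of th and pi/2, which is still below pi/2; also d
   <= 1, so |u| <= 2, hence the factors 2 in the exponents. *)
exists ((pi / 2 - th) / pi), (expR (- (2 * `|l|)) * cos ((th + pi / 2) / 2)),
  (expR (2 * `|l|)).
have d0 : 0 < (pi / 2 - th) / pi by rewrite divr_gt0// subr_gt0.
have d1 : (pi / 2 - th) / pi <= 1 by rewrite ler_pdivrMr//; lra.
have cc : 0 < cos ((th + pi / 2) / 2).
  by rewrite cos_gt0_pihalf//; apply/andP; split; lra.
split => //; first by rewrite mulr_gt0 ?expR_gt0.
move=> u /andP[ud1 ud2].
have ua : `|u| <= 1 + (pi / 2 - th) / pi by rewrite ler_norml; apply/andP; split; lra.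
have u2 : `|u| <= 2 by apply: le_trans ua _; lra.
have ul : `|u * l| <= 2 * `|l| by rewrite normrM ler_wpM2r.
have uth : `|u * carg z| <= (th + pi / 2) / 2.
  rewrite normrM -/th; apply: le_trans (ler_wpM2r th0 ua) _.
  have h1 : (pi / 2 - th) * th <= (pi / 2 - th) * (pi / 2).
    by rewrite ler_wpM2l//; lra.
  have ip : 0 <= (pi : R)^-1 by rewrite invr_ge0 ltW.
  have h2 := ler_wpM2r ip h1.
  have e : (pi / 2 - th) * (pi / 2) / pi = (pi / 2 - th) / 2.
    by rewrite -mulrA [pi / 2 / pi]mulrAC divff ?mul1r// gt_eqF.
  have e' : (pi / 2 - th) * th / pi = (pi / 2 - th) / pi * th by rewrite mulrAC.
  rewrite e e' in h2; rewrite mulrDl mul1r; lra.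
have e1 : Re (u%:C * clog z) = u * l by rewrite ReM/= mul0r subr0.
have e2 : Im (u%:C * clog z) = u * carg z by rewrite ImM/= mul0r addr0.
have e3 : Re (cexp (u%:C * clog z)) = expR (u * l) * cos (u * carg z).
  by rewrite -e1 -e2.
rewrite cabs_cexp e1 e3; split; last first.
  by rewrite ler_expR; apply: le_trans ul; exact: ler_norm.
apply: ler_pM; rewrite ?expR_ge0 ?(ltW cc)//.
  by rewrite ler_expR; move: ul; rewrite ler_norml => /andP[].
rewrite leNgt -(cos_norm (u * _)) ltr_cos ?in_itv/= -?leNgt//.
- by apply/andP; split; lra.
- by rewrite normr_ge0/=; lra.
Qed.

(* Along [u |-> z ^ u] the product of [z ^ (u * s)] with the integral is
   constant, which moves the base point of the integral from [1] to [z]. *)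
Lemma mellin_power z s : 0 < Re z -> 1 <= Re s ->
  mellin z (s - 1) (fun=> 1) = Gamma s * cpow z (- s).
Proof.
move=> z0 hs; have [zK _] := clogK_carg z0.
have [d [c [M [d0 c0 M0 path]]]] := cexp_path_bounds z0.
set L := clog z in zK path *; set w := s - 1.
pose zz u := cexp (u%:C * L).
have hw : 0 <= Re w by rewrite ReD/= subr_ge0.
have hw1 : 0%:R <= Re (w + 1) by rewrite subrK (le_trans ler01).
have zz0 u : - d < u < 1 + d -> 0 < Re (zz u).
  by move=> /path[h _]; exact: lt_le_trans h.
have dzL u (a : C) : is_cderive (fun u => a * (u%:C * L)) u (a * L).
  have h := is_cderiveM (is_cderive_cst a u) (is_cderiveM
    (is_cderive_real (is_derive_id u (1 : R))) (is_cderive_cst L u)).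
  by move: h; rewrite mul0r add0r mulr0 addr0 mul1r.
have dzz u : is_cderive zz u (L * zz u).
  have := is_cderive_cexp (dzL u 1).
  rewrite (_ : (fun u => cexp (1 * (u%:C * L))) = zz); last first.
    by apply/funext => v; rewrite mul1r.
  by rewrite !mul1r.
(* The integrand at the extreme point [c] dominates all those on the path; the exponent [w + 1] is
   that of the derivative in u, which brings down a factor t. *)
have [K K0 HK] := @mellin_term_bound _ 0 (fun=> 1) c%:C (w + 1) 0 (tame_cst 1) c0
  ltac:(by rewrite addr0).
have dF u : - d < u < 1 + d -> is_cderive (fun u => mellin (zz u) w (fun=> 1)) u
    (- (L * zz u) * mellin (zz u) (w + 1) (fun=> 1)).
  move=> ud; rewrite -cintegralZ; last first.
    exact: mellin_term_integrable (tame_cst 1) (zz0 _ ud) hw1.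
  apply: (@is_cderive_under_integral (fun u => mellin_term (zz u) w (fun=> 1))
    (fun u t => - (L * zz u) * mellin_term (zz u) (w + 1) (fun=> 1) t)
    (- d) (1 + d) (cabs L * M * K) (c / 2)) => //.
  - by rewrite divr_gt0.
  - by rewrite !mulr_ge0 ?cabs_ge0.
  - move=> v vd; exact: mellin_term_integrable (tame_cst 1) (zz0 _ vd) hw.
  - move=> v t vd t0; rewrite /mellin_term.
    have h1 := is_cderiveM (dzz v) (is_cderive_cst (- t%:C) v).
    have h2 := is_cderiveM (is_cderive_cst (cpow t%:C w * 1%:C) v) (is_cderive_cexp h1).
    apply: (@is_cderive_near_eq _ (fun v => cpow t%:C w * 1%:C * cexp (zz v * - t%:C))).
      by near=> v'; rewrite mulrN mulNr.
    move: h2; rewrite mul0r add0r mulr0 addr0 (_ : _ * (_ * _) =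
      - (L * zz v) * (cpow t%:C (w + 1) * 1%:C * cexp (- zz v * t%:C)))//.
    have -> : zz v * - t%:C = - zz v * t%:C by rewrite mulrN mulNr.
    by rewrite cpowD// (cpow1 t0); ring.
  - move=> v t vd t0; have [p1 p2] := path _ vd.
    set m := mellin_term _ _ _ _.
    rewrite ComplexField.Normc.normcM normcN ComplexField.Normc.normcM -!mulrA /m.
    rewrite ler_wpM2l ?cabs_ge0// ler_pM ?cabs_ge0//.
    have := HK _ t0; rewrite mul0r expR0 mul1r; apply: le_trans.
    rewrite !cabs_mellin_term// ler_wpM2l ?mulr_ge0 ?expR_ge0//.
    by rewrite ler_expR ler_wpM2r ?(ltW t0)// lerN2.
have dPhi u : - d < u < 1 + d ->
    is_cderive (fun u => cexp (s * (u%:C * L)) * mellin (zz u) w (fun=> 1)) u 0.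
  move=> ud; have h := is_cderiveM (is_cderive_cexp (dzL u s)) (dF _ ud).
  move: h; rewrite (_ : _ + _ = 0)//.
  (* As w + 1 = s, the derivative of z^(us) cancels that of the integral. *)
  have := @mellin1_by_parts _ (zz u) (w + 1) (zz0 _ ud) ltac:(by rewrite subrK).
  rewrite addrK -(subrK 1 s) -/w => e.
  transitivity (cexp ((w + 1) * (u%:C * L)) * L *
    ((w + 1) * mellin (zz u) w (fun=> 1) - zz u * mellin (zz u) (w + 1) (fun=> 1))).
    by ring.
  by rewrite e subrr mulr0.
have := @is_cderive0_eq _ 0 1 ltr01 (fun u hu => dPhi u ltac:(lra)).
rewrite /zz !mul0r mulr0 cexp0 mul1r mul1r zK GammaE -/w => ->.
by rewrite mulrAC -cexpD mulNr subrr cexp0 mul1r.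
Unshelve. all: by end_near. Qed.

End complex_powers.

(** * Termwise integration of series and multiple zeta values *)

Section series.
Context {R : realType}.
Local Notation mu := (@lebesgue_measure R).
Local Notation C := R[i].
Local Notation Re := (@complex.Re R).
Local Notation Im := (@complex.Im R).
Local Notation measurable_pos :=
  (measurable_fun (`]0, +oo[%classic : set (measurableTypeR R))).
Implicit Types (t : R) (n : nat).

Let mD : measurable (`]0, +oo[%classic : set (measurableTypeR R)).
Proof. exact: measurable_itv. Qed.

(** Unordered sums become ordinary series, codes of no element contributing 0, so that monotone
    convergence for series of integrals applies. *)
Lemma esum_countType (T : countType) (a : T -> \bar R) : (forall k, 0 <= a k)%E ->
  (\esum_(k in [set: T]) a k =
   \sum_(i <oo) oapp a 0%E (@choice.pickle_inv T i))%E.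
Proof.
move=> a0; pose b (i : nat) := oapp a 0%E (@choice.pickle_inv T i).
have b0 i : (0 <= b i)%E by rewrite /b; case: choice.pickle_inv => /=.
rewrite nneseries_esumT//.
have pinj : set_inj [set: T] (@choice.pickle T).
  by move=> x y _ _; exact: (pcan_inj choice.pickleK).
transitivity (\esum_(j in (@choice.pickle T) @` [set: T]) b j)%E.
  rewrite (@esum_image _ _ _ _ _ b pinj); apply: eq_esum => k _.
  by rewrite /b choice.pickleK_inv.
rewrite esum_mkcond; apply: eq_esum => i _; case: ifPn => // /negP h.
rewrite /b; case e : (choice.pickle_inv i) => [k|//]; exfalso; apply: h.
rewrite inE; exists k => //.
by have := @choice.pickle_invK T i; rewrite e.
Qed.

Lemma esumZl (T : countType) (c : R) (a : T -> \bar R) : 0 <= c ->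
  (forall k, 0 <= a k)%E ->
  (\esum_(k in [set: T]) (c%:E * a k) = c%:E * \esum_(k in [set: T]) a k)%E.
Proof.
move=> c0 a0; rewrite !esum_countType//; last by move=> k; rewrite mule_ge0.
rewrite -nneseriesZl//; last by move=> i _; case: choice.pickle_inv => /=.
by apply: eq_eseriesr => i _; case: choice.pickle_inv => //=; rewrite mule0.
Qed.

Lemma esum_geometric t : 0 < t ->
  (\esum_(i in [set: nat]) (expR (- (i%:R * t)))%:E = (geo t)%:E)%E.
Proof.
move=> t0; rewrite -nneseries_esumT; last by move=> i; rewrite lee_fin expR_ge0.
have e1 : `|expR (- t)| < 1.
  by rewrite ger0_norm ?expR_ge0// expR_lt1 oppr_lt0.
have := @cvg_geometric_series R 1 _ e1; rewrite mul1r -/(geo t) => h.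
apply/cvg_lim => //; rewrite (_ : (fun n => _) = EFin \o series (geometric 1 (expR (- t)))).
  by apply: cvg_EFin => //; exact: nearW.
apply/funext => m; rewrite /= /series /= sumEFin; congr EFin.
by apply: eq_bigr => i _; rewrite mul1r -expRM_natl mulrN.
Qed.

Definition ffun_cons n (p : nat * {ffun 'I_n -> nat}) : {ffun 'I_n.+1 -> nat} :=
  [ffun i => if unlift ord0 i is Some j then p.2 j else p.1].

Lemma ffun_cons_bij n : set_bij [set: nat * {ffun 'I_n -> nat}]
  [set: {ffun 'I_n.+1 -> nat}] (@ffun_cons n).
Proof.
split => //.
- move=> [i f] [j g] _ _ /ffunP h; congr pair.
    by have := h ord0; rewrite !ffunE unlift_none.
  by apply/ffunP => l; have := h (lift ord0 l); rewrite !ffunE liftK.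
- move=> f _; exists (f ord0, [ffun l => f (lift ord0 l)]) => //.
  apply/ffunP => i; rewrite !ffunE.
  by case: unliftP => [j ->|-> //]; rewrite ffunE.
Qed.

Lemma sum_ffun_cons n (p : nat * {ffun 'I_n -> nat}) :
  (\sum_(i < n.+1) ffun_cons p i = p.1 + \sum_(i < n) p.2 i)%N.
Proof.
rewrite big_ord_recl !ffunE unlift_none; congr addn.
by apply: eq_bigr => i _; rewrite ffunE liftK.
Qed.

(** Splitting off the first index makes the sum over N^(n+1) the product of a geometric series and
    the n-fold sum; N^0 has a single point. *)
Lemma esum_geoX n t : 0 < t ->
  (\esum_(k in [set: {ffun 'I_n -> nat}])
     (expR (- ((\sum_(i < n) k i)%:R * t)))%:E = (geo t ^+ n)%:E)%E.
Proof.
move=> t0; elim: n => [|n IH].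
  pose k0 : {ffun 'I_0 -> nat} := [ffun=> 0%N].
  have -> : [set: {ffun 'I_0 -> nat}] = [set k0].
    by apply/seteqP; split => // k _; apply/ffunP => -[].
  by rewrite esum_set1 ?lee_fin ?expR_ge0// big_ord0 mul0r oppr0 expR0 expr0.
rewrite (@reindex_esum _ _ _ _ _ _ _ (ffun_cons_bij n)).
have e0 (m : nat) : (0 <= (expR (- (m%:R * t)))%:E)%E by rewrite lee_fin expR_ge0.
transitivity (\esum_(i in [set: nat]) \esum_(k in [set: {ffun 'I_n -> nat}])
   ((expR (- (i%:R * t)))%:E * (expR (- ((\sum_(i < n) k i)%:R * t)))%:E))%E.
  rewrite esum_esum; last by move=> i k _ _; rewrite mule_ge0.
  rewrite (_ : _ `*`` _ = setT); last by apply/seteqP; split.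
  apply: eq_esum => -[i k] _ /=; rewrite sum_ffun_cons/=.
  by rewrite -EFinM -expRD natrD mulrDl opprD.
have g0 : 0 <= geo t ^+ n.
  by rewrite exprn_ge0// invr_ge0 ltW// geo_den_gt0.
transitivity (\esum_(i in [set: nat]) ((geo t ^+ n)%:E * (expR (- (i%:R * t)))%:E))%E.
  apply: eq_esum => i _; rewrite esumZl ?expR_ge0//.
  by rewrite IH muleC.
by rewrite esumZl// esum_geometric// -EFinM -exprSr.
Qed.

Section tonelli.
Variables (T : countType) (c : T -> R -> R) (q : R -> R).
Hypothesis c0 : forall k t, 0 < t -> 0 <= c k t.
Hypothesis mc : forall k, measurable_pos (c k).
Hypothesis mq : measurable_pos q.
Hypothesis cq : forall t, 0 < t -> (\esum_(k in [set: T]) (c k t)%:E = (q t)%:E)%E.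

Lemma le_esum_term k t : 0 < t -> c k t <= q t.
Proof.
move=> t0; rewrite -lee_fin -cq//; apply: esum_ge; exists [set k].
  by split.
by rewrite fsbig_set1.
Qed.

Lemma integrable_esum_term k (r : R -> R) : measurable_pos r ->
  mu.-integrable `]0, +oo[ (EFin \o (fun t => q t * r t)) ->
  mu.-integrable `]0, +oo[ (EFin \o (fun t => c k t * r t)).
Proof.
move=> mr; apply: (le_integrable mD).
  by apply/measurable_EFinP; exact: measurable_funM.
move=> t; rewrite /= in_itv/= andbT => t0; rewrite lee_fin !normrM ler_wpM2r//.
by rewrite ger0_norm ?c0// (le_trans (le_esum_term k t0))// ler_norm.
Qed.

Lemma esum_Rintegral_ge0 (r : R -> R) : (forall t, 0 <= r t) ->
  measurable_pos r ->
  mu.-integrable `]0, +oo[ (EFin \o (fun t => q t * r t)) ->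
  (\esum_(k in [set: T]) (\int[mu]_(t in `]0%R, +oo[) (c k t * r t))%R%:E =
   (\int[mu]_(t in `]0%R, +oo[) (q t * r t))%R%:E)%E.
Proof.
move=> r0 mr iq.
have i0 k : 0 <= \int[mu]_(t in `]0, +oo[) (c k t * r t).
  by apply: Rintegral_ge0 => t; rewrite /= in_itv/= andbT => t0; rewrite mulr_ge0// c0.
rewrite esum_countType; last by move=> k; rewrite lee_fin.
rewrite [in RHS]/Rintegral fineK; last exact: integrable_fin_num.
pose f i t := oapp (fun k => (c k t * r t)%:E) 0%E (@choice.pickle_inv T i).
transitivity (\int[mu]_(t in `]0%R, +oo[) \sum_(i <oo) f i t)%E; last first.
  apply: eq_integral => t; rewrite inE/= in_itv/= andbT => t0.
  rewrite -esum_countType; last by move=> k; rewrite lee_fin mulr_ge0 ?c0.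
  under eq_esum do rewrite mulrC EFinM.
  rewrite esumZl// ?cq// -?EFinM ?[r t * _]mulrC// => k.
  by rewrite lee_fin c0.
rewrite integral_nneseries//; first last.
- move=> i t; rewrite /= in_itv/= andbT => t0; rewrite /f.
  by case: choice.pickle_inv => [k|]//=; rewrite lee_fin mulr_ge0 ?c0.
- move=> i; rewrite /f; case: choice.pickle_inv => [k|]/=.
    by apply/measurable_EFinP; exact: measurable_funM.
  exact: measurable_cst.
apply: eq_eseriesr => i _; rewrite /f.
case: choice.pickle_inv => [k|]/=; last by rewrite integral0.
by rewrite /Rintegral fineK//; apply: integrable_fin_num => //; exact: integrable_esum_term.
Qed.

(** Monotone convergence is applied to the positive and the negative part of [r] separately;
    integrability of [q * r] makes both totals finite. *)
Lemma rsum_Rintegral (r : R -> R) : measurable_pos r ->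
  mu.-integrable `]0, +oo[ (EFin \o (fun t => q t * r t)) ->
  rsum (fun k => \int[mu]_(t in `]0, +oo[) (c k t * r t)) =
  \int[mu]_(t in `]0, +oo[) (q t * r t).
Proof.
move=> mr iq.
pose rp t := Num.max (r t) 0; pose rn t := Num.max (- r t) 0.
have rpn t : r t = rp t - rn t.
  by rewrite /rp /rn; case: (lerP (r t) 0); case: (lerP (- r t) 0) => ? ?; lra.
have rp0 t : 0 <= rp t by rewrite /rp le_max lexx orbT.
have rn0 t : 0 <= rn t by rewrite /rn le_max lexx orbT.
have mrp : measurable_pos rp by apply: measurable_maxr.
have mrn : measurable_pos rn.
  by apply: measurable_maxr => //; exact: measurable_funN.
have iq' (r' : R -> R) : measurable_pos r' ->
    (forall t, `|r' t| <= `|r t|) ->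
    mu.-integrable `]0, +oo[ (EFin \o (fun t => q t * r' t)).
  move=> mr' rr'; apply: (le_integrable mD _ _ iq).
    by apply/measurable_EFinP; exact: measurable_funM.
  by move=> t _; rewrite lee_fin !normrM ler_wpM2l.
have iqp : mu.-integrable `]0, +oo[ (EFin \o (fun t => q t * rp t)).
  apply: iq' => // t; rewrite ger0_norm// /rp ge_max normr_ge0 andbT.
  exact: ler_norm.
have iqn : mu.-integrable `]0, +oo[ (EFin \o (fun t => q t * rn t)).
  apply: iq' => // t; rewrite ger0_norm// /rn ge_max normr_ge0 andbT -normrN.
  exact: ler_norm.
pose A k := \int[mu]_(t in `]0, +oo[) (c k t * rp t).
pose B k := \int[mu]_(t in `]0, +oo[) (c k t * rn t).
have AB k : \int[mu]_(t in `]0, +oo[) (c k t * r t) = A k - B k.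
  rewrite /A /B -(RintegralB mD (integrable_esum_term k mrp iqp)
    (integrable_esum_term k mrn iqn)).
  by apply: eq_Rintegral => t _; rewrite rpn mulrBr.
have A0 k : 0 <= A k.
  by apply: Rintegral_ge0 => t; rewrite /= in_itv/= andbT => t0; rewrite mulr_ge0// c0.
have B0 k : 0 <= B k.
  by apply: Rintegral_ge0 => t; rewrite /= in_itv/= andbT => t0; rewrite mulr_ge0// c0.
have sA := esum_Rintegral_ge0 rp0 mrp iqp.
have sB := esum_Rintegral_ge0 rn0 mrn iqn.
have smA : summable [set: T] (EFin \o A).
  rewrite /summable; under eq_esum do rewrite /= ger0_norm//.
  by rewrite sA ltry.
have smB : summable [set: T] (EFin \o B).
  rewrite /summable; under eq_esum do rewrite /= ger0_norm//.
  by rewrite sB ltry.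
have smAB := summableB smA smB.
(* [rsum] splits each number [A k - B k] by its sign, which differs from splitting it into [A k] and
   [B k]; summability gives both the same difference. *)
have := @esumB _ _ _ _ _ smA smB (fun k _ => A0 k) (fun k _ => B0 k).
rewrite sA sB -EFinB -(RintegralB mD iqp iqn) => h.
transitivity (fine (\int[mu]_(t in `]0%R, +oo[) (q t * rp t - q t * rn t))%R%:E).
  rewrite -h fineB.
  - by rewrite (_ : (fun k => _) = fun k => A k - B k)//; apply/funext.
  - have := summable_funepos smAB; rewrite summableE.
    by under eq_esum do rewrite gee0_abs ?funepos_ge0//.
  - have := summable_funeneg smAB; rewrite summableE.
    by under eq_esum do rewrite gee0_abs ?funeneg_ge0//.
by apply: eq_Rintegral => t _; rewrite rpn mulrBr.
Qed.


End tonelli.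

Lemma csum_cintegral (T : countType) (c : T -> R -> R) (q : R -> R) (g : R -> C) :
  (forall k t, 0 < t -> 0 <= c k t) ->
  (forall k, measurable_pos (c k)) -> measurable_pos q ->
  (forall t, 0 < t -> (\esum_(k in [set: T]) (c k t)%:E = (q t)%:E)%E) ->
  measurable_pos (Re \o g) -> measurable_pos (Im \o g) ->
  cintegrable (fun t => (q t)%:C * g t) ->
  csum (fun k => cintegral `]0, +oo[ (fun t => (c k t)%:C * g t)) =
  cintegral `]0, +oo[ (fun t => (q t)%:C * g t).
Proof.
move=> c0 mc mq cq m1 m2 [i1 i2].
have eR (h : R -> R) : Re \o (fun t => (h t)%:C * g t) = (fun t => h t * (Re \o g) t).
  by apply/funext => t /=; rewrite ReM/= mul0r subr0.
have eI (h : R -> R) : Im \o (fun t => (h t)%:C * g t) = (fun t => h t * (Im \o g) t).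
  by apply/funext => t /=; rewrite ImM/= mul0r addr0.
rewrite eR in i1; rewrite eI in i2.
congr (_ +i* _).
- have := rsum_Rintegral c0 mc mq cq m1 i1; rewrite -(eR q) => <-.
  by congr rsum; apply/funext => k; rewrite -(eR (c k)).
- have := rsum_Rintegral c0 mc mq cq m2 i2; rewrite -(eI q) => <-.
  by congr rsum; apply/funext => k; rewrite -(eI (c k)).
Qed.

Lemma Rcontinuous_measurable (f : R -> R) :
  (forall t, 0 < t -> {for t, continuous f}) -> measurable_pos f.
Proof.
move=> cf; apply: open_continuous_measurable_fun => //.
by move=> t; rewrite inE/= in_itv/= andbT => /cf.
Qed.

(** By [mellin_power] each zeta term is an integral in which the index enters only through the
    nonnegative weight e^(-mt), with m the sum of the indices; these weights add up to f^n. *)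
Lemma mzeta_mellin n (s x : C) : 0 < Re x -> 1 <= Re s -> n%:R <= Re (s - 1) ->
  Gamma s != 0 -> mzeta n s x = (Gamma s)^-1 * mellin x (s - 1) (fun t => geo t ^+ n).
Proof.
move=> x0 hs hn Gs.
have tg : tame n (fun t => geo t ^+ n).
  by have := @tameX _ _ _ n (@tame_geo R); rewrite muln1.
have ig := mellin_term_integrable tg x0 hn.
pose g t := (Gamma s)^-1 * mellin_term x (s - 1) (fun=> 1) t.
have cg t : 0 < t -> ccontinuous_at g t.
  move=> t0; apply: ccontinuousZ; apply: mellin_term_continuous => //.
  exact: cst_continuous.
rewrite /mellin -(cintegralZ _ ig).
have eg : (fun t => (geo t ^+ n)%:C * g t) =
    (fun t => (Gamma s)^-1 * mellin_term x (s - 1) (fun t => geo t ^+ n) t).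
  by apply/funext => t; rewrite /g /mellin_term; ring.
rewrite -eg -(@csum_cintegral {ffun 'I_n -> nat}
  (fun k t => expR (- ((\sum_(i < n) k i)%:R * t)))); first last.
- rewrite eg; exact: cintegrableZ.
- by apply: Rcontinuous_measurable => t /cg[].
- by apply: Rcontinuous_measurable => t /cg[].
- by move=> t t0; exact: esum_geoX.
- by apply: Rcontinuous_measurable; exact: tg.1.
- move=> k; apply: Rcontinuous_measurable => t _.
  apply: continuous_comp; last exact: continuous_expR.
  apply: (@continuousN _ R^o); apply: continuousM => //.
  exact: cst_continuous.
- by move=> k t _; exact: expR_ge0.
congr csum; apply/funext => k; set m := (\sum_(i < n) k i)%N.
have xm : 0 < Re (x + m%:R).
  rewrite ReD (_ : Re m%:R = m%:R); last by rewrite (_ : m%:R = (m%:R)%:C)// rmorph_nat.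
  by rewrite ltr_wpDr.
have im : cintegrable (mellin_term (x + m%:R) (s - 1) (fun=> 1)).
  by apply: (mellin_term_integrable (tame_cst 1)) => //; rewrite ReD/= subr_ge0.
transitivity ((Gamma s)^-1 * mellin (x + m%:R) (s - 1) (fun=> 1)).
  by rewrite mellin_power// mulKf.
rewrite -(cintegralZ _ im); apply: eq_cintegral => t t0.
rewrite /g [RHS]mulrCA /mellin_term; congr (_ * _).
rewrite [RHS]mulrCA; congr (_ * _); rewrite -cexp_real -cexpD; congr cexp.
by rewrite rmorphN rmorphM rmorph_nat; ring.
Qed.

End series.

(** * Gamma has no zero with real part at least 1 *)

Section Gamma_nonvanishing.
Context {R : realType}.
Local Notation mu := (@lebesgue_measure R).
Local Notation C := R[i].
Local Notation Re := (@complex.Re R).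
Local Notation Im := (@complex.Im R).
Implicit Types (t b y : R) (s : C).

Let mD : measurable (`]0, +oo[%classic : set (measurableTypeR R)).
Proof. exact: measurable_itv. Qed.

Let pos_mem t : t \in (`]0, +oo[%classic : set R) -> 0 < t.
Proof. by rewrite inE/= in_itv/= andbT. Qed.

Lemma sin_le_id y : 0 <= y -> sin y <= y.
Proof.
rewrite le_eqVlt => /orP[/eqP<-|y0]; first by rewrite sin0.
have [|c _] := @MVT _ (@sin R) (@cos R) 0 y y0.
- by apply: continuous_subspaceT => u; exact: continuous_sin.
rewrite sin0 !subr0 => ->; rewrite ler_piMl ?(ltW y0)//; exact: cos_le1.
Qed.

Lemma cos_ge_quadratic y : 1 - y ^+ 2 / 2 <= cos y.
Proof.
wlog y0 : y / 0 <= y.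
  move=> H; case: (lerP 0 y) => [|/ltW y0]; first exact: H.
  by rewrite -cosN -sqrrN H// oppr_ge0.
have -> : cos y = 1 - 2 * sin (y / 2) ^+ 2.
  rewrite {1}(splitr y) -mulr2n cos_mulr2n cos2sin2; ring.
have h1 : sin (y / 2) <= y / 2 by apply: sin_le_id; lra.
have h2 : - (y / 2) <= sin (y / 2).
  case: (lerP (y / 2) pi) => h.
    have : 0 <= sin (y / 2) by apply: sin_ge0_pi; apply/andP; split; lra.
    lra.
  have := sin_geN1 (y / 2); have := pi_ge2 R; lra.
have : sin (y / 2) ^+ 2 <= (y / 2) ^+ 2.
  by rewrite -subr_ge0 subr_sqr mulr_ge0//; lra.
have -> : (y / 2) ^+ 2 = y ^+ 2 / 4 by field.
lra.
Qed.

(** At y = (ln t - ln N) / 2 the right side is t/N - 2 + N/t, which trades a squared logarithm for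
    powers of t that only shift the argument of Gamma. *)
Lemma sqr_le_expRB y : y ^+ 2 <= (expR y - expR (- y)) ^+ 2.
Proof.
wlog y0 : y / 0 <= y.
  move=> H; case: (lerP 0 y) => [|/ltW y0]; first exact: H.
  have := H (- y); rewrite oppr_ge0 opprK sqrrN => /(_ y0).
  by rewrite -(sqrrN (expR y - _)) opprB.
have h1 := expR_ge1Dx y.
have h2 : expR (- y) <= 1 by rewrite expR_le1 oppr_le0.
by rewrite ler_sqr ?nnegrE; lra.
Qed.

Definition gker b t : R := expR (b * ln t) * expR (- t).
(** The real value Gamma(b + 1). *)
Definition Gamma1p b : R := \int[mu]_(t in `]0, +oo[) gker b t.

Lemma mellin_term_gker b t : 0 < t -> mellin_term 1 b%:C (fun=> 1) t = (gker b t)%:C.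
Proof.
move=> t0; rewrite /mellin_term mulr1 cpow_real// mulN1r -rmorphN -!rmorphM.
by rewrite !cexp_real -rmorphM.
Qed.

Lemma integrable_gker b : 0 <= b -> mu.-integrable `]0, +oo[ (EFin \o gker b).
Proof.
move=> b0; have [h _] := @mellin_term_integrable _ 0 (fun=> 1) 1 b%:C
  (tame_cst 1) ltr01 b0.
apply: (eq_integrable mD _ _ _ h) => t /pos_mem t0.
by rewrite /comp mellin_term_gker.
Qed.

Lemma Re_mellin_gker b : Re (mellin 1 b%:C (fun=> 1)) = Gamma1p b.
Proof.
apply: eq_Rintegral => t /pos_mem t0.
by rewrite /comp mellin_term_gker.
Qed.

Lemma Gamma1p_succ b : 0 <= b -> Gamma1p (b + 1) = (b + 1) * Gamma1p b.
Proof.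
move=> b0; have := @mellin1_by_parts _ 1 (b + 1)%:C ltr01 ltac:(by rewrite /= lerDr).
have -> : (b + 1)%:C - 1 = b%:C by rewrite rmorphD addrK.
rewrite mul1r => /(congr1 Re).
by rewrite ReM !Re_mellin_gker /= mul0r subr0 => <-.
Qed.

Lemma Gamma1p0 : Gamma1p 0 = 1.
Proof.
transitivity (\int[mu]_(t in `]0, +oo[) expR (- t)).
  by apply: eq_Rintegral => t _; rewrite /gker mul0r expR0 mul1r.
have i1 := integrable_expRN (@ltr01 R).
have i2 : mu.-integrable `]0, +oo[ (EFin \o (fun t => expR (- t))).
  by apply: (eq_integrable mD _ _ _ i1) => t _ /=; rewrite mulN1r.
rewrite (Rintegral_itv_obnd_cbnd i2).
have dE (t : R) : is_derive t 1 (fun t => - expR (- t)) (expR (- t)).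
  have h := is_deriveN (is_derive1_comp (is_derive_expR (- t))
    (is_deriveN (is_derive_id t (1 : R)))).
  by apply: is_derive_eq h _; ring.
have cE (t : R) : {for t, continuous (fun t => expR (- t))}.
  by apply: continuous_comp; [exact: opp_continuous|exact: continuous_expR].
rewrite (@Rintegral_ge0_continuous_FTC2y _ _ (fun t => - expR (- t)) 0 0).
- by rewrite oppr0 expR0 opprK add0r.
- by move=> t _; exact: expR_ge0.
- by apply: continuous_subspaceT => t; exact: cE.
- by rewrite -oppr0; apply: cvgN; exact: cvgr_expR.
- by move=> t _; have [] := dE t.
- by apply/cvg_at_right_filter; apply: is_derive_continuous (dE 0).
- by move=> t _; rewrite derive1E; have [] := dE t.
Qed.

(* Bernoulli's inequality [t ^ b >= b * t - (b - 1)] integrates to [Gamma1p b >= 1]. *)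
Lemma Gamma1p_ge1 b : 1 <= b -> 1 <= Gamma1p b.
Proof.
move=> b1.
have i0 := integrable_gker (lexx 0); have i1 := integrable_gker (@ler01 R).
have ib := integrable_gker (le_trans ler01 b1).
have j1 : Gamma1p 1 = 1 by rewrite -[1]add0r Gamma1p_succ// Gamma1p0 add0r mulr1.
have iz1 : mu.-integrable `]0, +oo[ (EFin \o (fun t => b * gker 1 t)).
  exact: (integrableZl mD b i1).
have iz0 : mu.-integrable `]0, +oo[ (EFin \o (fun t => (b - 1) * gker 0 t)).
  exact: (integrableZl mD (b - 1) i0).
(* The Bernoulli minorant integrates to b - (b - 1), as Gamma(1) = Gamma(2) = 1. *)
have <- : \int[mu]_(t in `]0, +oo[) (b * gker 1 t - (b - 1) * gker 0 t) = 1.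
  rewrite (RintegralB mD iz1 iz0) (RintegralZl _ mD i1) (RintegralZl _ mD i0).
  by rewrite -/(Gamma1p 1) -/(Gamma1p 0) j1 Gamma1p0; ring.
apply: (le_Rintegral mD) => //; first exact: (integrableB mD iz1 iz0).
move=> t; rewrite /= in_itv/= andbT => t0; rewrite /gker mul0r expR0 !mul1r.
rewrite lnK ?posrE// mulrA -mulrBl ler_wpM2r ?expR_ge0//.
have -> : b * ln t = ln t + (b - 1) * ln t by ring.
rewrite expRD lnK ?posrE//.
have h1 := expR_ge1Dx ((b - 1) * ln t).
have h2 : 1 - t^-1 <= ln t.
  have : -1 < t^-1 - 1 by rewrite ltrBrDr addNr invr_gt0.
  by move=> /le_ln1Dx; rewrite [1 + _]addrC subrK lnV ?posrE//; lra.
have h3 : (b - 1) * (1 - t^-1) <= (b - 1) * ln t by rewrite ler_wpM2l// subr_ge0.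
have h4 : t * (1 + (b - 1) * (1 - t^-1)) <= t * expR ((b - 1) * ln t).
  by rewrite ler_wpM2l ?(ltW t0)//; lra.
apply: le_trans h4; rewrite le_eqVlt; apply/orP; left; apply/eqP.
by field; rewrite gt_eqF.
Qed.

Lemma gker_shift b (k : R) t : 0 < t -> gker (b + k) t = expR (k * ln t) * gker b t.
Proof. by move=> t0; rewrite /gker mulrDl expRD; ring. Qed.

(* The oscillation of [t ^ (i tau)] relative to its value at [t = N] is damped
   by the concentration of [t ^ (N - 1) * e ^ (- t)] around [N]. *)
Lemma Gamma_neq0_large s : 3 <= Re s -> 1 + 2 * Im s ^+ 2 < Re s -> Gamma s != 0.
Proof.
set N := Re s; set tau := Im s => N3 Ntau; apply/eqP => G0.
have N0 : 0 < N by lra.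
(* Multiplication by N^(-i tau) makes the phase zero at t = N, so the real part of the integrand
   carries a cosine that is close to 1 there. *)
pose rot := cexp (- (0 +i* tau) * (ln N)%:C).
have is1 : cintegrable (mellin_term 1 (s - 1) (fun=> 1)).
  by apply: (mellin_term_integrable (tame_cst 1)) => //=; rewrite ReD/= -/N; lra.
have eT t : 0 < t -> Re (rot * mellin_term 1 (s - 1) (fun=> 1) t) =
    gker (N - 1) t * cos (tau * (ln t - ln N)).
  move=> t0; rewrite /mellin_term /rot mulr1 cpow_real// -!cexpD.
  rewrite /cexp/= /gker -expRD; congr (expR _ * cos _).
    by rewrite !(ReD, ReM, ImM)/= -/N; ring.
  by rewrite !(ImD, ReM, ImM)/= -/tau; ring.
have i2 : mu.-integrable `]0, +oo[
    (EFin \o (fun t => gker (N - 1) t * cos (tau * (ln t - ln N)))).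
  have [h _] := cintegrableZ rot is1.
  apply: (eq_integrable mD _ _ _ h) => t; rewrite inE/= in_itv/= andbT => t0.
  by rewrite -eT.
have I0 : \int[mu]_(t in `]0, +oo[) (gker (N - 1) t * cos (tau * (ln t - ln N))) = 0.
  transitivity (Re (rot * Gamma s)); last by rewrite G0 mulr0.
  rewrite GammaE -(cintegralZ _ is1); apply: eq_Rintegral => t /pos_mem t0.
  by rewrite -eT.
have ia := integrable_gker (_ : 0 <= N - 1); have {}ia := ia ltac:(lra).
have ib := integrable_gker (_ : 0 <= N); have {}ib := ib ltac:(lra).
have ic := integrable_gker (_ : 0 <= N - 2); have {}ic := ic ltac:(lra).
have ia' : mu.-integrable `]0, +oo[ (EFin \o (fun t => (1 + 4 * tau ^+ 2) * gker (N - 1) t)).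
  exact: (integrableZl mD _ ia).
have ib' : mu.-integrable `]0, +oo[ (EFin \o (fun t => (2 * tau ^+ 2 / N) * gker N t)).
  exact: (integrableZl mD _ ib).
have ic' : mu.-integrable `]0, +oo[ (EFin \o (fun t => (2 * tau ^+ 2 * N) * gker (N - 2) t)).
  exact: (integrableZl mD _ ic).
have iab : mu.-integrable `]0, +oo[ (EFin \o (fun t => (1 + 4 * tau ^+ 2) * gker (N - 1) t
    - (2 * tau ^+ 2 / N) * gker N t)).
  exact: (integrableB mD ia' ib').
have iabc : mu.-integrable `]0, +oo[ (EFin \o (fun t => ((1 + 4 * tau ^+ 2) * gker (N - 1) t
    - (2 * tau ^+ 2 / N) * gker N t) - (2 * tau ^+ 2 * N) * gker (N - 2) t)).
  exact: (integrableB mD iab ic').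
(* The integrand is [gker (N - 1) t] times 1 - 2 tau^2 (t/N - 2 + N/t), a lower bound for the
   cosine; t and 1/t shift the exponent to N and N - 2. *)
have : \int[mu]_(t in `]0, +oo[) (((1 + 4 * tau ^+ 2) * gker (N - 1) t
    - (2 * tau ^+ 2 / N) * gker N t) - (2 * tau ^+ 2 * N) * gker (N - 2) t) <= 0.
  rewrite -[leRHS]I0; apply: (le_Rintegral mD iabc i2) => t.
  rewrite /= in_itv/= andbT => t0.
  have r0 : 0 <= gker (N - 1) t by rewrite mulr_ge0 ?expR_ge0.
  have -> : gker N t = t * gker (N - 1) t.
    have := gker_shift (N - 1) 1 t0; rewrite subrK => ->.
    by rewrite mul1r lnK ?posrE.
  have -> : gker (N - 2) t = t^-1 * gker (N - 1) t.
    have := gker_shift (N - 1) (-1) t0; rewrite -addrA -opprD => ->.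
    by rewrite mulN1r expRN lnK ?posrE.
  set y := (ln t - ln N) / 2.
  have hy := sqr_le_expRB y.
  have e1 : expR y ^+ 2 = t / N.
    rewrite expr2 -expRD /y -splitr -ln_div ?posrE// lnK ?posrE//.
    by rewrite divr_gt0.
  have e2 : expR (- y) ^+ 2 = N / t.
    by rewrite expRN exprVn e1 invf_div.
  have e3 : expR y * expR (- y) = 1 by exact: expRxMexpNx_1.
  have hc := cos_ge_quadratic (tau * (ln t - ln N)).
  have e4 : (tau * (ln t - ln N)) ^+ 2 = tau ^+ 2 * (4 * y ^+ 2).
    by rewrite /y; field.
  have hy' : y ^+ 2 <= t / N - 2 + N / t.
    apply: le_trans hy _; rewrite sqrrB e1 e2 e3; lra.
  have hy2 : tau ^+ 2 * (4 * y ^+ 2) <= tau ^+ 2 * (4 * (t / N - 2 + N / t)).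
    by rewrite ler_wpM2l ?sqr_ge0//; lra.
  have : gker (N - 1) t * (1 - tau ^+ 2 * (4 * (t / N - 2 + N / t)) / 2) <=
      gker (N - 1) t * cos (tau * (ln t - ln N)).
    by rewrite ler_wpM2l//; lra.
  apply: le_trans; rewrite le_eqVlt; apply/orP; left; apply/eqP.
  by field; rewrite !gt_eqF.
rewrite (RintegralB mD iab ic') (RintegralB mD ia' ib').
rewrite (RintegralZl _ mD ia) (RintegralZl _ mD ib) (RintegralZl _ mD ic).
rewrite -/(Gamma1p (N - 1)) -/(Gamma1p N) -/(Gamma1p (N - 2)).
have -> : Gamma1p N = N * Gamma1p (N - 1) by rewrite -{1 2}[N](subrK 1) Gamma1p_succ//; lra.
have -> : Gamma1p (N - 1) = (N - 1) * Gamma1p (N - 2).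
  have -> : N - 1 = N - 2 + 1 by ring.
  by rewrite Gamma1p_succ//; lra.
(* [N >= 3] enters here. The three integrals collapse to (N - 1 - 2 tau^2) Gamma(N - 1), which is
   positive, against the bound by 0. *)
have j1 : 1 <= Gamma1p (N - 2) by apply: Gamma1p_ge1; lra.
have -> : (1 + 4 * tau ^+ 2) * ((N - 1) * Gamma1p (N - 2)) -
  2 * tau ^+ 2 / N * (N * ((N - 1) * Gamma1p (N - 2))) - 2 * tau ^+ 2 * N * Gamma1p (N - 2) =
  (N - 1 - 2 * tau ^+ 2) * Gamma1p (N - 2) by field; rewrite gt_eqF.
by apply/negP; rewrite -ltNge mulr_gt0//; lra.
Qed.

Lemma Gamma_neq0 s : 1 <= Re s -> Gamma s != 0.
Proof.
move=> s1; apply/negP => /eqP G0.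
have ReN (n : nat) : Re (s + n%:R) = Re s + n%:R.
  by rewrite ReD (_ : n%:R = (n%:R)%:C)// rmorph_nat.
have ImN (n : nat) : Im (s + n%:R) = Im s.
  by rewrite ImD (_ : n%:R = (n%:R)%:C) ?addr0// rmorph_nat.
have Gn (n : nat) : Gamma (s + n%:R) = 0.
  elim: n => [|n IH]; first by rewrite addr0.
  rewrite -natr1 addrA GammaD1 ?IH ?mulr0// ReN.
  by apply: le_trans s1 _; rewrite lerDl.
(* This shift meets both thresholds of [Gamma_neq0_large], the imaginary part being unchanged. *)
pose n := (Num.truncn (3 + 2 * Im s ^+ 2)).+1.
have hn : 3 + 2 * Im s ^+ 2 < n%:R by exact: truncnS_gt.
have /eqP := Gn n; apply/negP; apply: Gamma_neq0_large; rewrite ReN ?ImN.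
  by have := sqr_ge0 (Im s); lra.
lra.
Qed.

End Gamma_nonvanishing.

Local Arguments stirling2 : simpl never.

(** * Evaluation of the remaining integrals and assembly of the formula *)

Section evaluation.
Context {R : realType}.
Local Notation C := R[i].
Local Notation Re := (@complex.Re R).
Implicit Types (s x w : C) (n : nat).

Lemma Re_natr n : Re n%:R = n%:R.
Proof. by rewrite (_ : n%:R = (n%:R)%:C)// rmorph_nat. Qed.

Lemma mellin_geoX x s n : 0 < Re x -> 1 <= Re s -> n%:R <= Re (s - 1) ->
  mellin x (s - 1) (fun t => geo t ^+ n) = Gamma s * mzeta n s x.
Proof.
by move=> x0 s1 hn; rewrite mzeta_mellin ?Gamma_neq0// mulVKf ?Gamma_neq0.
Qed.

Lemma mellin_geo_sum x s a (c : nat -> R) : 0 < Re x -> a.+1%:R <= Re s - 1 ->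
  mellin x (s - 1) (fun t => \sum_(0 <= i < a) c i * geo t ^+ i.+2) =
  Gamma s * \sum_(0 <= i < a) (c i)%:C * mzeta i.+2 s x.
Proof.
move=> x0 hs.
have hs' : a.+1%:R <= Re (s - 1) by rewrite ReD.
have a0 : 1 <= a.+1%:R :> R by rewrite ler1n.
have tg n : tame n (fun t : R => geo t ^+ n).
  by have := @tameX _ _ _ n (@tame_geo R); rewrite muln1.
rewrite (@mellin_sum _ a.+1)//; last first.
  move=> i; rewrite mem_index_iota => /andP[_ ia]; apply: tameZ.
  by apply: tameW (tg _).
rewrite big_distrr/=; apply: eq_big_nat => i /andP[_ ia].
have hi : i.+2%:R <= Re (s - 1) by apply: le_trans hs'; rewrite ler_nat.
rewrite (mellinZ _ (tg _))// mellin_geoX//; first by ring.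
lra.
Qed.

(** The product of G^(a) and G is t^2 f f^(a) + a t f f^(a-1), with f^(a) the [a]-th derivative. The
    powers t^2 and t raise the zeta arguments to s + 2 and s + 1, and Gamma(s + 2), Gamma(s + 1)
    supply s (s + 1) and s. *)
Lemma mellin_dG0 x s a : 0 < Re x -> a.+1%:R <= Re s ->
  mellin_dG x (s - 1) a 0 = Gamma s * \sum_(0 <= i < a.+1)
    (-1) ^+ i * i`!%:R *
    ((stirling2 a.+1 i.+1)%:R * s * (s + 1) * mzeta i.+2 (s + 2) x +
     a%:R * (stirling2 a i.+1)%:R * s * mzeta i.+2 (s + 1) x).
Proof.
move=> x0 hs.
have s1 : 1 <= Re s by apply: le_trans hs; rewrite ler1n.
have aS : a.+1%:R = a%:R + 1 :> R by rewrite natr1.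
have aSS : a.+2%:R = a%:R + 2 :> R by rewrite -addn2 natrD.
pose c2 i : R := a%:R * ((-1) ^+ i * i`!%:R * (stirling2 a i.+1)%:R).
(* S(a, a+1) = 0 lets the shorter sum run over the same range as the other one. *)
have c2a : c2 a = 0 by rewrite /c2 stirling2_gt// !mulr0.
have tg n : tame n (fun t : R => geo t ^+ n).
  by have := @tameX _ _ _ n (@tame_geo R); rewrite muln1.
pose f1 (t : R) := \sum_(0 <= i < a.+1) dgeo_coef a i * geo t ^+ i.+2.
pose f2 (t : R) := \sum_(0 <= i < a) c2 i * geo t ^+ i.+2.
have e0 t : 0 < t -> dG a t * dG 0 t = t * (t * f1 t) + t * f2 t.
  move=> t0; rewrite dG0 /dG mulrDl; congr (_ + _).
    rewrite -mulrA [dgeo a t * _]mulrCA; congr (_ * (_ * _)).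
    rewrite /dgeo /f1 mulrC big_distrr/=; apply: eq_bigr => i _.
    by rewrite [in RHS]exprS; ring.
  rewrite mulrCA; congr (_ * _); rewrite /f2 /c2.
  case: (a) => [|b]; first by rewrite !mul0r big_geq.
  rewrite /dgeo /= -mulrA big_distrl big_distrr/=; apply: eq_bigr => i _.
  by rewrite /dgeo_coef [in RHS]exprSr; ring.
have tf1 : tame a.+2 f1.
  apply: tame_sum => i; rewrite mem_index_iota => /andP[_ ia]; apply: tameZ.
  by apply: tameW (tg _).
have tf2 : tame a.+1 f2.
  apply: tame_sum => i; rewrite mem_index_iota => /andP[_ ia]; apply: tameZ.
  by apply: tameW (tg _).
rewrite /mellin_dG (eq_mellin _ _ e0).
rewrite (mellinD (tame_mul_id (tame_mul_id tf1)) (tame_mul_id tf2) x0); last first.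
  by rewrite ReD/=; lra.
rewrite !mellin_mul_id.
have -> : s - 1 + 1 + 1 = s + 2 - 1 by ring.
have -> : s - 1 + 1 = s + 1 - 1 by ring.
rewrite mellin_geo_sum//; last by rewrite ReD/=; lra.
rewrite mellin_geo_sum//; last by rewrite ReD/=; lra.
have G2 : Gamma (s + 2) = (s + 1) * s * Gamma s.
  have -> : s + 2 = s + 1 + 1 by ring.
  by rewrite !GammaD1 ?mulrA// ReD/=; lra.
rewrite G2 GammaD1// (_ : \sum_(0 <= i < a) _ =
  \sum_(0 <= i < a.+1) (c2 i)%:C * mzeta i.+2 (s + 1) x); last first.
  by rewrite big_nat_recr//= c2a rmorph0 mul0r addr0.
rewrite !big_distrr -big_split/=; apply: eq_bigr => i _.
rewrite /dgeo_coef /c2 !rmorphM !rmorphXn rmorphN1 !rmorph_nat.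
by ring.
Qed.

(** The exponents brought down by [k] lowerings are exactly the factors by which the functional
    equation climbs from s - k back to s. *)
Lemma falling_Gamma s k : k.+1%:R <= Re s ->
  falling (s - 1) k * Gamma (s - k%:R) = Gamma s.
Proof.
elim: k => [|k IH] hs; first by rewrite /falling big_nil mul1r subr0.
have hk : k.+2%:R = k%:R + 2 :> R by rewrite -addn2 natrD.
rewrite /falling big_nat_recr//= -/(falling _ _) -IH; last first.
  by apply: le_trans hs; rewrite ler_nat.
rewrite -mulrA; congr (_ * _).
have -> : s - k%:R = s - k.+1%:R + 1 by rewrite -natr1; ring.
rewrite GammaD1; first by rewrite -natr1; congr (_ * _); ring.
rewrite ReD (_ : Re (- _) = - k.+1%:R); last by rewrite raddfN/= Re_natr.
by rewrite -natr1; lra.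
Qed.

(** The first binomial chooses the steps that leave the first factor alone, the second those among
    them that lower the exponent. *)
Lemma trinomialE m i k : (k <= i <= m)%N ->
  trinomial R m (m - i) (i - k) k = 'C(m, i)%:R * 'C(i, k)%:R.
Proof.
move=> /andP[ki im]; rewrite /trinomial -(bin_fact im) -(bin_fact ki) !natrM.
have f0 n : (n`!%:R : C) != 0 by rewrite pnatr_eq0 -lt0n fact_gt0.
by field; rewrite !f0.
Qed.

Lemma Z_mellin_dG m1 m2 s x :
  Z m1 m2 s x = (Gamma s)^-1 * mellin_dG x (s - 1) m1 m2.
Proof.
congr (_ * _); apply: eq_cintegral => t t0.
by rewrite /mellin_term !derive1n_G// rmorphM/= -!mulrA.
Qed.

End evaluation.

Theorem theorem5 (R : realType) (m1 m2 : nat) (s x : R[i])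
    (hx : 0 < complex.Re x) (hs : (m1 + m2 + 2)%:R < complex.Re s) :
  Z m1 m2 s x =
  \sum_(0 <= k2 < m2.+1) \sum_(0 <= k < k2.+1)
    let a := (m1 + m2 - k2)%N in
    \sum_(1 <= j < a.+2)
      (-1) ^+ (j + m2 - 1) * (j - 1)`!%:R
      * trinomial R m2 (m2 - k2) (k2 - k) k * (- x) ^+ (k2 - k)
      * ((stirling2 a.+1 j)%:R * (s - k%:R) * (s - k%:R + 1)
           * mzeta j.+1 (s - k%:R + 2) x
         + a%:R * (stirling2 a j)%:R * (s - k%:R)
           * mzeta j.+1 (s - k%:R + 1) x).
Proof.
have s1 : 1 <= complex.Re s.
  by apply: le_trans (ltW hs); rewrite ler1n addn2.
have G0 := Gamma_neq0 s1.
rewrite Z_mellin_dG mellin_dG_expand//; last first.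
  rewrite ReD/=; move: hs; rewrite !natrD; lra.
rewrite big_distrr big_distrr/=; apply: eq_big_nat => k2 /andP[_ k2m].
rewrite /by_parts_iter !big_distrr/=; apply: eq_big_nat => k /andP[_ kk2].
(* Because k <= k2, the sum of [a.+1] and k is at most m1 + m2 + 1. *)
have hsk : (m1 + m2 - k2).+1%:R <= complex.Re (s - k%:R).
  rewrite ReD (_ : complex.Re (- _) = - k%:R); last by rewrite raddfN/= Re_natr.
  rewrite lerBrDr; apply: le_trans (ltW hs); rewrite -natrD ler_nat; lia.
rewrite [s - 1 - k%:R]addrAC mellin_dG0//.
(* In this form the prefactor cancels what the term with index k produces. *)
have -> : (Gamma s)^-1 = (falling (s - 1) k * Gamma (s - k%:R))^-1.
  rewrite falling_Gamma//; apply: le_trans (ltW hs); rewrite ler_nat; lia.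
have fG : falling (s - 1) k * Gamma (s - k%:R) != 0.
  rewrite falling_Gamma//; apply: le_trans (ltW hs); rewrite ler_nat; lia.
(* Reindexing by j = i + 1 turns the sign exponent into i + m2 and the factorial into i!. *)
rewrite [RHS]big_add1/= !big_distrr/=; apply: eq_big_nat => i _.
rewrite addSn !subn1/= trinomialE; last first.
  by rewrite (ltnSE kk2) (ltnSE k2m).
rewrite exprD.
set u := (stirling2 _ _)%:R * _ * _ * _ + _.
move: fG; set p := falling _ _; set g := Gamma _ => fG.
have e : (p * g)^-1 * (p * g) = 1 by rewrite mulVf.
transitivity ((p * g)^-1 * (p * g) * ((-1) ^+ m2 * 'C(m2, k2)%:R * 'C(k2, k)%:R *
  (- x) ^+ (k2 - k) * ((-1) ^+ i * i`!%:R * u))); first by ring.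
by rewrite e mul1r /u; ring.
Qed.
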